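(* Let $S$ be a translation surface. If the group $\mathrm{Iso}(J(S))$ is isomorphic, as an abstract group, to $SL(2,K)$ for some field $K$, then $S$ is algebraically periodic and $K$ is (isomorphic to) its periodic direction field.
   Context: A translation surface is a compact (connected, oriented) surface $S$ obtained by gluing finitely many polygons in $\mathbb{R}^2$ along parallel edges by translations. View $\mathbb{R}^2$ and $\mathbb{R}$ as $\mathbb{Q}$-vector spaces. Take an edge-to-edge decomposition of $S$ into Euclidean triangles $\Delta_j$ whose vertex set contains the singular points, and let $v_j,w_j\in\mathbb{R}^2$ be two successive sides of $\Delta_j$ in counterclockwise order. The $J$-invariant is $J(S)=\sum_j v_j\wedge w_j\in\mathbb{R}^2\wedge_{\mathbb{Q}}\mathbb{R}^2$ (independent of the triangulation). $\mathrm{Iso}(J(S))$ is the group of $\alpha\in SL(2,\mathbb{R})$ that fix $J(S)$ under the induced action $v\wedge w\mapsto \alpha v\wedge\alpha w$ on $\mathbb{R}^2\wedge_{\mathbb{Q}}\mathbb{R}^2$. For $0\ne v\in\mathbb{R}^2$ let $\pi:\mathbb{R}^2\to\mathbb{R}$ be the orthogonal projection with kernel $\mathbb{R}v$, and let $\mathrm{SAF}_v(S)\in\mathbb{R}\wedge_{\mathbb{Q}}\mathbb{R}$ be the image of $J(S)$ under the map induced by $\pi$. The direction $v$ is algebraically periodic if $\mathrm{SAF}_v(S)=0$. $S$ is algebraically periodic if it has at least three algebraically periodic directions. In that case, after a linear change of coordinates so that the directions of slopes $0,1,\infty$ are algebraically periodic, the set of finite slopes of algebraically periodic directions is a subfield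 of $\mathbb{R}$ (independent of the choices), called the periodic direction field of $S$. *)

(* Defs.v *)
From HB Require Import structures.
From mathcomp Require Import all_boot all_order all_algebra.
From mathcomp Require Import generic_quotient ring_quotient freeg.
From mathcomp Require Import boolp classical_sets reals.

Set Implicit Arguments.
Unset Strict Implicit.
Unset Printing Implicit Defensive.

Import Order.TTheory GRing.Theory Num.Theory.

Local Open Scope ring_scope.
Local Open Scope quotient_scope.

Section ExteriorSquare.
Variable V : lmodType rat.

Inductive ext_relator : {freeg (V * V)%type / rat} -> Prop :=
| ExtAlt (v : V) : ext_relator << (v, v) >>
| ExtAddl (u v w : V) :
    ext_relator (<< (u + v, w) >> - << (u, w) >> - << (v, w) >>)
| ExtAddr (u v w : V) :
    ext_relator (<< (u, v + w) >> - << (u, v) >> - << (u, w) >>)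
| ExtScalel (q : rat) (v w : V) :
    ext_relator (<< (q *: v, w) >> - q *: << (v, w) >>)
| ExtScaler (q : rat) (v w : V) :
    ext_relator (<< (v, q *: w) >> - q *: << (v, w) >>).

Inductive ext_null : {freeg (V * V)%type / rat} -> Prop :=
| ExtNull0 : ext_null 0
| ExtNullZD (q : rat) r x :
    ext_relator r -> ext_null x -> ext_null (q *: r + x).

Lemma ext_nullD x y : ext_null x -> ext_null y -> ext_null (x + y).
Proof.
elim=> [|q r z rr _ IH] ny; first by rewrite add0r.
by rewrite -addrA; apply: ExtNullZD => //; apply: IH.
Qed.

Lemma ext_nullZ q x : ext_null x -> ext_null (q *: x).
Proof.
elim=> [|p r z rr _ IH]; first by rewrite scaler0; constructor.
by rewrite scalerDr scalerA; apply: ExtNullZD.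
Qed.

Definition ext_nullb : {pred {freeg (V * V)%type / rat}} :=
  [pred x | `[< ext_null x >]].

Lemma ext_nullb_zmod_closed : zmod_closed ext_nullb.
Proof.
split=> [|x y]; first by apply/asboolP; constructor.
move=> /asboolP nx /asboolP ny; apply/asboolP.
by rewrite -scaleN1r; apply: ext_nullD => //; apply: ext_nullZ.
Qed.

HB.instance Definition _ :=
  GRing.isZmodClosed.Build _ ext_nullb ext_nullb_zmod_closed.

(* V /\_Q V: the free Q-module on V * V modulo the span of the relators. *)
Definition ext_sq := ring_quotient.Quotient.quot ext_nullb.
HB.instance Definition _ := GRing.Zmodule.on ext_sq.
HB.instance Definition _ := EqQuotient.on ext_sq.

Lemma ext_piP x y : \pi_ext_sq x = \pi_ext_sq y <-> ext_null (x - y).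
Proof.
split=> [/eqP|n]; last apply/eqP; rewrite -ring_quotient.Quotient.idealrBE.
  by move/asboolP.
exact/asboolP.
Qed.

Lemma ext_piD x y : \pi_ext_sq (x + y) = \pi_ext_sq x + \pi_ext_sq y.
Proof. exact: (ring_quotient.Quotient.pi_add ext_nullb x y). Qed.

Definition ext_scale (q : rat) (x : ext_sq) : ext_sq :=
  \pi_ext_sq (q *: repr x).

Lemma ext_scale_pi q x : ext_scale q (\pi_ext_sq x) = \pi_ext_sq (q *: x).
Proof.
apply/ext_piP; rewrite -scalerBr; apply: ext_nullZ.
by apply/ext_piP; rewrite reprK.
Qed.

Lemma ext_scaleA p q x : ext_scale p (ext_scale q x) = ext_scale (p * q) x.
Proof. by rewrite -[x]reprK (ext_scale_pi q) !ext_scale_pi scalerA. Qed.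

Lemma ext_scale1 : left_id 1 ext_scale.
Proof. by move=> x; rewrite -[x]reprK ext_scale_pi scale1r. Qed.

Lemma ext_scaleDr : right_distributive ext_scale +%R.
Proof.
move=> q x y; rewrite -[x]reprK -[y]reprK.
by rewrite -ext_piD !ext_scale_pi scalerDr ext_piD.
Qed.

Lemma ext_scaleDl x : {morph ext_scale^~ x : p q / p + q}.
Proof.
by move=> p q; rewrite -[x]reprK !ext_scale_pi scalerDl ext_piD.
Qed.

HB.instance Definition _ := GRing.Zmodule_isLmodule.Build rat ext_sq
  ext_scaleA ext_scale1 ext_scaleDr ext_scaleDl.

Definition wedge (v w : V) : ext_sq := \pi_ext_sq << (v, w) >>.

Lemma ext_pi0 : \pi_ext_sq 0 = 0.
Proof. by apply: (addrI (\pi_ext_sq 0)); rewrite -ext_piD !addr0. Qed.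

Lemma ext_piZ q x : \pi_ext_sq (q *: x) = q *: \pi_ext_sq x.
Proof. by rewrite -ext_scale_pi. Qed.

Lemma ext_piB x y : \pi_ext_sq (x - y) = \pi_ext_sq x - \pi_ext_sq y.
Proof. by rewrite -scaleN1r ext_piD ext_piZ scaleN1r. Qed.

Lemma ext_pi_relator r : ext_relator r -> \pi_ext_sq r = 0.
Proof.
move=> rr; rewrite -ext_pi0; apply/ext_piP.
rewrite subr0 -[r]scale1r -[_ *: _]addr0.
by apply: ExtNullZD => //; constructor.
Qed.

Lemma wedge_alt v : wedge v v = 0.
Proof. exact/ext_pi_relator/ExtAlt. Qed.

Lemma wedgeDl u v w : wedge (u + v) w = wedge u w + wedge v w.
Proof.
apply/eqP; rewrite -subr_eq0 opprD addrA -!ext_piB.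
exact/eqP/ext_pi_relator/ExtAddl.
Qed.

Lemma wedgeDr u v w : wedge u (v + w) = wedge u v + wedge u w.
Proof.
apply/eqP; rewrite -subr_eq0 opprD addrA -!ext_piB.
exact/eqP/ext_pi_relator/ExtAddr.
Qed.

Lemma wedgeZl q v w : wedge (q *: v) w = q *: wedge v w.
Proof.
apply/eqP; rewrite -subr_eq0 -ext_piZ -ext_piB.
exact/eqP/ext_pi_relator/ExtScalel.
Qed.

Lemma wedgeZr q v w : wedge v (q *: w) = q *: wedge v w.
Proof.
apply/eqP; rewrite -subr_eq0 -ext_piZ -ext_piB.
exact/eqP/ext_pi_relator/ExtScaler.
Qed.

Lemma ext_sq_ind (P : ext_sq -> Prop) :
  P 0 -> (forall q v w x, P x -> P (q *: wedge v w + x)) -> forall x, P x.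
Proof.
move=> P0 PD x; rewrite -[x]reprK -[repr x]freeg_sumE; move: (repr x) => {}x.
elim: (dom x) => [|[v w] s IH]; first by rewrite big_nil ext_pi0.
rewrite big_cons ext_piD -[coeff _ _]mulr1.
have -> : << coeff (v, w) x * 1 *g (v, w) >> =
          coeff (v, w) x *: << (v, w) >> :> {freeg (V * V)%type / rat}.
  by apply/eqP/freeg_eqP => z; rewrite coeffZ !coeffU mulr1 mul1r.
by rewrite ext_piZ; apply: PD.
Qed.

(* The map on V /\_Q V induced by an alternating bilinear b; see ext_liftE. *)
Definition ext_lift (W : lmodType rat) (b : V -> V -> W) (x : ext_sq) : W :=
  fglift (fun p : V * V => b p.1 p.2) (repr x).

Section Lift.
Variables (W : lmodType rat) (b : V -> V -> W).
Hypothesis b_alt : forall v, b v v = 0.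
Hypothesis b_linl : forall w, linear (b^~ w).
Hypothesis b_linr : forall v, linear (b v).

Let lift := fglift (fun p : V * V => b p.1 p.2).

Let liftB x y : lift (x - y) = lift x - lift y.
Proof. exact: lift_is_additive. Qed.

Let lift0 : lift 0 = 0.
Proof. by rewrite -[X in lift X](subrr 0) liftB subrr. Qed.

Let liftD x y : lift (x + y) = lift x + lift y.
Proof.
by rewrite -[y in LHS]opprK liftB -[in lift (- y)]sub0r liftB lift0 sub0r opprK.
Qed.

Let lift_sum (I : Type) (s : seq I) F :
  lift (\sum_(i <- s) F i) = \sum_(i <- s) lift (F i).
Proof. exact: (big_morph _ liftD lift0). Qed.

Let liftZ q x : lift (q *: x) = q *: lift x.
Proof.
have -> : lift x = \sum_(z <- dom x) coeff z x *: b z.1 z.2.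
  rewrite -[x in LHS]freeg_sumE lift_sum.
  by apply: eq_bigr => z _; rewrite /lift liftU.
rewrite [q *: x]/(fgscale q x) /fgscale lift_sum scaler_sumr.
by apply: eq_bigr => z _; rewrite /lift liftU scalerA.
Qed.

Let lift_null x : ext_null x -> lift x = 0.
Proof.
elim=> [|q r z rr _ IH]; first exact: lift0.
rewrite liftD IH addr0 liftZ.
suff -> : lift r = 0 by rewrite scaler0.
have U v w : lift << (v, w) >> = b v w by rewrite /lift liftU scale1r.
case: rr => [v|u v w|u v w|p v w|p v w]; rewrite ?liftB ?liftZ !U ?b_alt //.
- by have := b_linl w 1 u v; rewrite !scale1r => ->; rewrite addrAC addrK subrr.
- by have := b_linr u 1 v w; rewrite !scale1r => ->; rewrite addrAC addrK subrr.
- have := b_linl w p v 0; rewrite addr0 => ->.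
  have /= := b_linl w (-1) 0 0; rewrite scaler0 addr0 scaleN1r addNr => ->.
  by rewrite addr0 subrr.
- have := b_linr v p w 0; rewrite addr0 => ->.
  have /= := b_linr v (-1) 0 0; rewrite scaler0 addr0 scaleN1r addNr => ->.
  by rewrite addr0 subrr.
Qed.

Let ext_lift_pi x : ext_lift b (\pi_ext_sq x) = lift x.
Proof.
apply/eqP; rewrite -subr_eq0 -liftB; apply/eqP/lift_null/ext_piP.
by rewrite reprK.
Qed.

Lemma ext_liftE v w : ext_lift b (wedge v w) = b v w.
Proof. by rewrite ext_lift_pi /lift liftU scale1r. Qed.

Lemma ext_lift_linear : linear (ext_lift b).
Proof.
move=> q x y; rewrite -[x]reprK -[y]reprK.
by rewrite -ext_piZ -ext_piD !ext_lift_pi liftD liftZ.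
Qed.

End Lift.

End ExteriorSquare.

Definition ext_map (V W : lmodType rat) (f : V -> W) : ext_sq V -> ext_sq W :=
  ext_lift (fun v w => wedge (f v) (f w)).

Lemma ext_mapE (V W : lmodType rat) (f : {linear V -> W}) v w :
  ext_map f (wedge v w) = wedge (f v) (f w).
Proof.
apply: (@ext_liftE _ _ (fun v w => wedge (f v) (f w))) => [u|u q x y|u q x y].
- exact: wedge_alt.
- by rewrite linearP wedgeDl wedgeZl.
- by rewrite linearP wedgeDr wedgeZr.
Qed.

Lemma ext_map_linear (V W : lmodType rat) (f : {linear V -> W}) :
  linear (ext_map f).
Proof.
apply: ext_lift_linear => [u|u q x y|u q x y].
- exact: wedge_alt.
- by rewrite linearP wedgeDl wedgeZl.
- by rewrite linearP wedgeDr wedgeZr.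
Qed.

HB.instance Definition _ (V W : lmodType rat) (f : {linear V -> W}) :=
  GRing.isLinear.Build rat (ext_sq V) (ext_sq W) _ (ext_map f)
    (ext_map_linear f).

Definition Qmod (R : numFieldType) (V : lmodType R) : Type := V.

Section RestrictScalars.
Variables (R : numFieldType) (V : lmodType R).

HB.instance Definition _ := GRing.Zmodule.on (Qmod V).

Definition Qscale (q : rat) (v : Qmod V) : Qmod V := ratr q *: (v : V).

Lemma QscaleA p q v : Qscale p (Qscale q v) = Qscale (p * q) v.
Proof. by rewrite /Qscale scalerA rmorphM. Qed.

Lemma Qscale1 : left_id 1 Qscale.
Proof. by move=> v; rewrite /Qscale rmorph1 scale1r. Qed.

Lemma QscaleDr : right_distributive Qscale +%R.
Proof. by move=> q u v; rewrite /Qscale scalerDr. Qed.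

Lemma QscaleDl v : {morph Qscale^~ v : p q / p + q}.
Proof. by move=> p q; rewrite /Qscale rmorphD scalerDl. Qed.

HB.instance Definition _ := GRing.Zmodule_isLmodule.Build rat (Qmod V)
  QscaleA Qscale1 QscaleDr QscaleDl.

End RestrictScalars.

Section Plane.
Variable R : realType.

Definition plane : lmodType rat := Qmod 'cV[R]_2.
Definition line : lmodType rat := Qmod R^o.

Definition vec2 (x y : R) : 'cV[R]_2 := \col_i (if i == 0 then x else y).

Definition cross (v w : 'cV[R]_2) : R := v 0 0 * w 1 0 - v 1 0 * w 0 0.

Definition plane_act (g : 'M[R]_2) (v : plane) : plane := g *m (v : 'cV[R]_2).

Lemma plane_act_linear g : linear (plane_act g).
Proof. by move=> q v w; rewrite /plane_act mulmxDr -scalemxAr. Qed.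

HB.instance Definition _ g :=
  GRing.isLinear.Build rat plane plane _ (plane_act g) (plane_act_linear g).

Lemma plane_act1 v : plane_act 1%:M v = v.
Proof. exact: mul1mx. Qed.

Lemma plane_actM g h v : plane_act (g *m h) v = plane_act g (plane_act h v).
Proof. by rewrite /plane_act mulmxA. Qed.

Definition bivector_act (g : 'M[R]_2) : ext_sq plane -> ext_sq plane :=
  ext_map (plane_act g).

HB.instance Definition _ g := GRing.Linear.on (bivector_act g).

Lemma bivector_actE g v w :
  bivector_act g (wedge v w) = wedge (plane_act g v) (plane_act g w).
Proof. exact: ext_mapE. Qed.

Lemma bivector_act1 : bivector_act 1%:M =1 id.
Proof.
apply: ext_sq_ind => [|q v w x IH]; first exact: linear0.
by rewrite linearP /= bivector_actE !plane_act1 IH.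
Qed.

Lemma bivector_actM g h :
  bivector_act (g *m h) =1 bivector_act g \o bivector_act h.
Proof.
apply: ext_sq_ind => [|q v w x IH] /=; first by rewrite !linear0.
by rewrite !linearP /= IH !bivector_actE !plane_actM.
Qed.

(* Orthogonal projection along v, i.e. onto the line orthogonal to v; that
   line is identified with R by its unit vector (- v_1, v_0) / |v|. *)
Definition ortho_proj (v : 'cV[R]_2) (w : plane) : line :=
  cross v w / Num.sqrt (v 0 0 ^+ 2 + v 1 0 ^+ 2).

Lemma cross_linear v : scalar (cross v).
Proof.
move=> a x y; rewrite /cross !mxE !mulrDr !(mulrCA _ a) opprD addrACA.
by rewrite mulrN.
Qed.

Lemma ortho_proj_linear v : linear (ortho_proj v).
Proof.
move=> q x y; set N := Num.sqrt (v 0 0 ^+ 2 + v 1 0 ^+ 2).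
transitivity ((ratr q * cross v x + cross v y) / N).
  by rewrite -cross_linear.
by rewrite mulrDl -mulrA.
Qed.

HB.instance Definition _ v :=
  GRing.isLinear.Build rat plane line _ (ortho_proj v) (ortho_proj_linear v).

Definition SAF (v : 'cV[R]_2) : ext_sq plane -> ext_sq line :=
  ext_map (ortho_proj v).

Definition periodic_direction (J : ext_sq plane) (v : 'cV[R]_2) : Prop :=
  v != 0 /\ SAF v J = 0.

Definition periodic_slopes (J : ext_sq plane) : set R :=
  [set s | periodic_direction J (vec2 1 s)].

End Plane.

Section SL2.
Variable K : fieldType.

Record SL2 := MkSL2 { SL2_val :> 'M[K]_2; _ : \det SL2_val == 1 }.

HB.instance Definition _ := [isSub for SL2_val].
HB.instance Definition _ := [Choice of SL2 by <:].

Implicit Types a b c : SL2.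

Lemma det_SL2 a : \det (val a) = 1. Proof. exact/eqP/(valP a). Qed.

Lemma SL2_unitmx a : val a \in unitmx.
Proof. by rewrite unitmxE det_SL2 unitr1. Qed.

Definition SL2_one : SL2 := MkSL2 (introT eqP (det1 K 2)).

Lemma SL2_mul_subproof a b : \det (val a *m val b) == 1.
Proof. by rewrite det_mulmx !det_SL2 mulr1. Qed.
Definition SL2_mul a b : SL2 := MkSL2 (SL2_mul_subproof a b).

Lemma SL2_inv_subproof a : \det (invmx (val a)) == 1.
Proof. by rewrite det_inv det_SL2 invr1. Qed.
Definition SL2_inv a : SL2 := MkSL2 (SL2_inv_subproof a).

Lemma SL2_mulA : associative SL2_mul.
Proof. by move=> a b c; apply/val_inj/mulmxA. Qed.
Lemma SL2_mul1g : left_id SL2_one SL2_mul.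
Proof. by move=> a; apply/val_inj/mul1mx. Qed.
Lemma SL2_mulg1 : right_id SL2_one SL2_mul.
Proof. by move=> a; apply/val_inj/mulmx1. Qed.
Lemma SL2_mulVg : left_inverse SL2_one SL2_inv SL2_mul.
Proof. by move=> a; apply/val_inj/mulVmx/SL2_unitmx. Qed.
Lemma SL2_mulgV : right_inverse SL2_one SL2_inv SL2_mul.
Proof. by move=> a; apply/val_inj/mulmxV/SL2_unitmx. Qed.

HB.instance Definition _ := isGroup.Build SL2
  SL2_mulA SL2_mul1g SL2_mulg1 SL2_mulVg SL2_mulgV.

End SL2.

Section Iso.
Variables (R : realType) (J : ext_sq (plane R)).

Definition fixes_bivector : pred (SL2 R) :=
  [pred a : SL2 R | `[< bivector_act a J = J >]].

Lemma fixes_bivector_group_closed : group_closed fixes_bivector.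
Proof.
split=> [|a b /asboolP aJ /asboolP bJ]; apply/asboolP.
  exact: bivector_act1.
rewrite [SL2_val _]/(val a *m invmx (val b)) bivector_actM /= -[in LHS]bJ.
have /= <- := bivector_actM (invmx (val b)) b J.
by rewrite mulVmx ?SL2_unitmx // bivector_act1.
Qed.

Record Iso := MkIso { Iso_val :> SL2 R; _ : fixes_bivector Iso_val }.

HB.instance Definition _ := [isSub for Iso_val].
HB.instance Definition _ := [Choice of Iso by <:].
HB.instance Definition _ := SubChoice_isSubGroup.Build (SL2 R) fixes_bivector
  Iso fixes_bivector_group_closed.

End Iso.

Definition group_isomorphic (G H : groupType) : Prop :=
  exists f : {multiplicative G -> H}, bijective f.

(* K is isomorphic to L, a subset of F; in particular L is a subfield of F
   (ring morphisms between fields are injective). *)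
Definition isomorphic_to_subfield (K F : fieldType) (L : set F) : Prop :=
  exists f : {rmorphism K -> F}, range f = L.

(* A translation surface, presented by an edge-to-edge triangulation: finitely
   many counterclockwise Euclidean triangles, up to translation, whose sides are
   glued in pairs by translations.  [side t i] is the i-th side of t in
   counterclockwise order, as a vector; as both triangles are oriented, glued
   sides are opposite vectors.  A side is never glued to itself, since
   [side_ccw] and [side_closed] make its vector nonzero. *)
Record translation_surface (R : realType) := TranslationSurface {
  triangle : finType;
  side : triangle -> 'I_3 -> 'cV[R]_2;
  glue : triangle * 'I_3 -> triangle * 'I_3;
  side_closed : forall t, \sum_i side t i = 0;
  side_ccw : forall t, 0 < cross (side t 0) (side t 1);
  glueK : involutive glue;
  side_glue : forall e, side (glue e).1 (glue e).2 = - side e.1 e.2;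
  surface_nonempty : (0 < #|triangle|)%N;
  surface_connected : forall t u,
    connect [rel t u | [exists i, (glue (t, i)).1 == u]] t u
}.

Section SurfaceInvariants.
Variables (R : realType) (S : translation_surface R).

Definition J_invariant : ext_sq (plane R) :=
  \sum_(t : triangle S) wedge (side t 0 : plane R) (side t 1 : plane R).

(* Directions are counted as unoriented lines: v and - v are the same one. *)
Definition algebraically_periodic : Prop :=
  exists v : 'I_3 -> 'cV[R]_2,
    (forall i, periodic_direction J_invariant (v i)) /\
    (forall i j, i != j -> cross (v i) (v j) != 0).

(* The change of coordinates g replaces J(S) by its image under g (up to sign
   when det g < 0, which does not affect the periodic directions). *)
Definition periodic_direction_field (L : set R) : Prop :=
  exists g : 'M[R]_2, let J := bivector_act g J_invariant in
    [/\ g \in unitmx,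
        periodic_direction J (vec2 1 0),
        periodic_direction J (vec2 1 1),
        periodic_direction J (vec2 0 1) &
        L = periodic_slopes J].

End SurfaceInvariants.

(* Main.v *)
Require Import Defs.
From HB Require Import structures.
From mathcomp Require Import all_boot all_order all_algebra.
From mathcomp Require Import boolp classical_sets reals.
From mathcomp Require Import ring lra.

(** An abstract embedding of SL(2,K) in SL(2,R) is, up to conjugation, induced
    by a field embedding F : K -> R. Indeed char K = 0, since otherwise -1 is a
    sum of two squares and SL(2,K) contains a quaternion group, which SL(2,R)
    does not. A transvection u(b) is conjugate to u(4b) = u(b)^4, which forces
    its image to have trace 2; the upper and lower transvections then fix two
    distinct lines, and in these coordinates u(b) goes to u(F b). So Iso(J(S)) is
    conjugate to SL(2, F K).

    If u(1) fixes J, evaluating a polarized alternating form at J = u(1) J shows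
    that the horizontal direction is algebraically periodic; by equivariance, so
    are all directions with slope in F K. Conversely, if the slopes 0, 1, oo and s
    are periodic, exchanging the coordinates acts on J by -1, and u(s) fixes J;
    being in SL(2, F K), it has s in F K. Finally any other normalizing
    coordinate change sends the slopes 0, 1, oo to points of the projective line
    over F K, so it is in GL(2, F K) up to a scalar and preserves F K. *)

Set Implicit Arguments.
Unset Strict Implicit.
Unset Printing Implicit Defensive.

Import Order.TTheory GRing.Theory Num.Theory.

Local Open Scope ring_scope.

(** * Two-by-two matrices *)

Section Matrix22.
Variable F : fieldType.
Implicit Types (a b c d : F) (M N : 'M[F]_2).

Definition mx22 a b c d : 'M[F]_2 :=
  \matrix_(i, j) if i == 0 then (if j == 0 then a else b)
                 else (if j == 0 then c else d).

Lemma ord2P (P : 'I_2 -> Prop) : P 0 -> P 1 -> forall i, P i.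
Proof.
move=> P0 P1 [[|[|//]] lti].
- by rewrite (_ : Ordinal lti = 0) //; apply: val_inj.
- by rewrite (_ : Ordinal lti = 1) //; apply: val_inj.
Qed.

Lemma mx22_eta M : M = mx22 (M 0 0) (M 0 1) (M 1 0) (M 1 1).
Proof. by apply/matrixP => i j; move: i j; do 2!apply: ord2P; rewrite !mxE. Qed.

Lemma mx22P M : exists a b c d, M = mx22 a b c d.
Proof. by do 4!eexists; exact: mx22_eta. Qed.

Lemma mx22_inj a b c d a' b' c' d' :
  mx22 a b c d = mx22 a' b' c' d' -> [/\ a = a', b = b', c = c' & d = d'].
Proof.
move=> /matrixP e.
by have := (e 0 0, e 0 1, e 1 0, e 1 1); rewrite !mxE /= => -[[[]]].
Qed.

Lemma mulmx22 a b c d a' b' c' d' :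
  mx22 a b c d *m mx22 a' b' c' d' =
  mx22 (a * a' + b * c') (a * b' + b * d') (c * a' + d * c') (c * b' + d * d').
Proof.
apply/matrixP => i j; move: i j.
by do 2!apply: ord2P; rewrite !mxE !big_ord_recl big_ord0 !mxE /= addr0.
Qed.

Lemma det_mx22 a b c d : \det (mx22 a b c d) = a * d - b * c.
Proof.
rewrite (expand_det_row _ 0) !big_ord_recl big_ord0 addr0 /cofactor !det_mx11.
by rewrite !mxE /= addn0 expr0 expr1; ring.
Qed.

Lemma mxtrace22 a b c d : \tr (mx22 a b c d) = a + d.
Proof. by rewrite /mxtrace !big_ord_recl big_ord0 !mxE /= addr0. Qed.

Lemma addmx22 a b c d a' b' c' d' :
  mx22 a b c d + mx22 a' b' c' d' = mx22 (a + a') (b + b') (c + c') (d + d').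
Proof. by apply/matrixP => i j; move: i j; do 2!apply: ord2P; rewrite !mxE. Qed.

Lemma oppmx22 a b c d : - mx22 a b c d = mx22 (- a) (- b) (- c) (- d).
Proof. by apply/matrixP => i j; move: i j; do 2!apply: ord2P; rewrite !mxE. Qed.

Lemma scalar_mx22 a : a%:M = mx22 a 0 0 a.
Proof. by apply/matrixP => i j; move: i j; do 2!apply: ord2P; rewrite !mxE. Qed.

Lemma scalemx22 k a b c d :
  k *: mx22 a b c d = mx22 (k * a) (k * b) (k * c) (k * d).
Proof. by apply/matrixP => i j; move: i j; do 2!apply: ord2P; rewrite !mxE. Qed.

Definition upper b := mx22 1 b 0 1.
Definition lower c := mx22 1 0 c 1.
Definition weyl := mx22 0 1 (-1) 0.

Lemma det_upper b : \det (upper b) == 1.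
Proof. by rewrite det_mx22; apply/eqP; ring. Qed.

Lemma det_lower b : \det (lower b) == 1.
Proof. by rewrite det_mx22; apply/eqP; ring. Qed.

Lemma det_weyl : \det weyl == 1.
Proof. by rewrite det_mx22; apply/eqP; ring. Qed.

(** The characteristic polynomial at 1 is [1 - \tr M + \det M = 0], so [M - 1] is singular. The
    transpose appears because [det0P] produces a row vector. *)
Lemma unipotent_fixed_vector M :
  \det M = 1 -> \tr M = 2 ->
  exists2 v : 'cV[F]_2, v != 0 & M *m v = v.
Proof.
move=> dM tM.
have d0 : \det (M - 1%:M)^T = 0.
  rewrite det_tr; have [a [b [c [d e]]]] := mx22P M.
  move: dM tM; rewrite e scalar_mx22 oppmx22 addmx22 !det_mx22 mxtrace22 => dM tM.
  transitivity (a * d - b * c - (a + d) + 1); first by ring.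
  by rewrite dM tM; ring.
have /det0P[v v0 vM] : \det (M - 1%:M)^T == 0 by rewrite d0.
exists v^T; first by rewrite -trmx0 (inj_eq trmx_inj).
apply/eqP; rewrite -subr_eq0 -[X in _ - X]mul1mx -mulmxBl -[_ *m _]trmxK.
by rewrite trmx_mul trmxK vM trmx0.
Qed.

(** Cayley-Hamilton multiplied by [M ^+ n], then traced: power traces are Chebyshev-type polynomials
    in [\tr M]. *)
Lemma mxtraceXn M n :
  \det M = 1 -> \tr (M ^+ n.+2) = \tr M * \tr (M ^+ n.+1) - \tr (M ^+ n).
Proof.
move=> dM; rewrite !exprS; have [x [y [z [t ->]]]] := mx22P (M ^+ n).
move: dM; have [a [b [c [d ->]]]] := mx22P M; rewrite det_mx22 -!mulmxE => dM.
rewrite !mulmx22 !mxtrace22.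
rewrite -[X in _ = _ - X]mul1r -dM; ring.
Qed.

(* Cayley-Hamilton. *)
Lemma mulmx_traceZ M : \det M = 1 -> M *m M = \tr M *: M - 1%:M.
Proof.
have [a [b [c [d ->]]]] := mx22P M; rewrite det_mx22 => dM.
rewrite mulmx22 mxtrace22 scalar_mx22 scalemx22 oppmx22 addmx22 -dM.
by congr mx22; ring.
Qed.

End Matrix22.

(** Both matrices have trace zero, and the relations then give [(b * g - c * f) ^+ 2 = - 4 * (1 + a
    ^+ 2 + e ^+ 2)], a negative square. *)
Lemma no_anticommuting_roots (R : realFieldType) (M N : 'M[R]_2) :
  M *m M = - 1%:M -> N *m N = - 1%:M -> M *m N = - (N *m M) -> False.
Proof.
have [a [b [c [d ->]]]] := mx22P M; have [e [f [g [h ->]]]] := mx22P N.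
rewrite !scalar_mx22 !mulmx22 !oppmx22.
move=> /mx22_inj[m1 m2 m3 m4] /mx22_inj[n1 n2 n3 n4] /mx22_inj[e1 _ _ _].
(* The corner entry of the square is [b * (a + d) = 0]; a nonzero trace would give [b = 0], hence
   [a ^+ 2 = -1]. *)
have ad : d = - a.
  have [s0|s0] := eqVneq (a + d) 0; first by lra.
  have b0 : b = 0 by apply: (mulfI s0); rewrite mulr0; lra.
  by nra.
have he : h = - e.
  have [s0|s0] := eqVneq (e + h) 0; first by lra.
  have b0 : f = 0 by apply: (mulfI s0); rewrite mulr0; lra.
  by nra.
have bc : b * c = - 1 - a ^+ 2 by lra.
have fg : f * g = - 1 - e ^+ 2 by lra.
have bg : b * g + c * f = - 2 * a * e by lra.
have pr : (b * g) * (c * f) = (1 + a ^+ 2) * (1 + e ^+ 2).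
  by transitivity ((b * c) * (f * g)); [ring | rewrite bc fg; ring].
have := sqr_ge0 (b * g - c * f).
have -> : (b * g - c * f) ^+ 2 = (b * g + c * f) ^+ 2 - 4 * ((b * g) * (c * f)).
  by ring.
rewrite bg pr; have := sqr_ge0 a; have := sqr_ge0 e; lra.
Qed.

(* Pigeonhole: more than half of the elements of F_p are squares. *)
Lemma minus_one_sum_squares p :
  prime p -> odd p -> exists x y : 'F_p, x ^+ 2 + y ^+ 2 = -1.
Proof.
move=> pp op; pose S := [set x ^+ 2 | x : 'F_p]%SET.
have cS : (p <= 2 * #|S|)%N.
  rewrite -[leqLHS](card_Fp pp) -[leqLHS]sum1_card.
  rewrite (partition_big (fun x : 'F_p => x ^+ 2) (mem S)) /=; last first.
    by move=> x _; apply/imsetP; exists x.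
  rewrite [leqRHS](_ : _ = \sum_(y in S) 2)%N; last by rewrite sum_nat_const mulnC.
  apply: leq_sum => y /imsetP[x0 _ ->].
  rewrite sum1_card; apply: (@leq_trans #|[set x0; - x0]%SET|).
    by apply: subset_leq_card; apply/fintype.subsetP => x; rewrite !inE -eqf_sqr.
  by rewrite cards2 ltnS leq_b1.
(* A common point of [S] and [T] is the desired identity. If they were disjoint, [2 * #|S| <= p] and
   [cS] would make [p] even. *)
pose T := [set - 1 - s | s in S]%SET.
have cT : #|T| = #|S|.
  by apply: card_imset => x y /addrI /oppr_inj.
have [disj|] := boolP [disjoint S & T].
  have : (#|S| + #|T| <= p)%N.
    rewrite -[X in (_ <= X)%N](card_Fp pp) -(leq_card_setU S T).2 in disj *.
    by rewrite -(eqP disj) max_card.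
  rewrite cT addnn -mul2n => le; have : p = (2 * #|S|)%N.
    by apply/eqP; rewrite eqn_leq cS.
  by move=> e; move: op; rewrite e mul2n odd_double.
rewrite -setI_eq0 => /set0Pn[_ /setIP[/imsetP[x _ ->] /imsetP[_ /imsetP[y _ ->] e]]].
by exists x, y; rewrite e addrNK.
Qed.

(** * Embeddings of SL(2,K) in SL(2,R) *)

Section SL2Elements.
Variable K : fieldType.

Definition SLupper (b : K) : SL2 K := MkSL2 (det_upper b).
Definition SLlower (c : K) : SL2 K := MkSL2 (det_lower c).
Definition SLweyl : SL2 K := MkSL2 (det_weyl K).

Lemma SL2_valM (x y : SL2 K) : val (x * y)%g = val x *m val y.
Proof. by []. Qed.

Lemma SLupper0 : SLupper 0 = 1%g.
Proof. by apply: val_inj; rewrite /= scalar_mx22. Qed.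

Lemma SLlower0 : SLlower 0 = 1%g.
Proof. by apply: val_inj; rewrite /= scalar_mx22. Qed.

Lemma SLupperD b c : SLupper (b + c) = (SLupper b * SLupper c)%g.
Proof. by apply: val_inj; rewrite /= mulmx22; congr mx22; ring. Qed.

Lemma SLlowerD b c : SLlower (b + c) = (SLlower b * SLlower c)%g.
Proof. by apply: val_inj; rewrite /= mulmx22; congr mx22; ring. Qed.

(** As a word in transvections, the Weyl element has its image determined by theirs. *)
Lemma SLweylE : SLweyl = (SLupper 1 * SLlower (-1) * SLupper 1)%g.
Proof. by apply: val_inj; rewrite /= !mulmx22; congr mx22; ring. Qed.

Lemma SLweyl_upper b : (SLweyl * SLupper b = SLlower (- b) * SLweyl)%g.
Proof. by apply: val_inj; rewrite /= !mulmx22; congr mx22; ring. Qed.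

(** Conjugation by the diagonal matrix with entries [t] and [t^-1]. It serves with [t = 2] for the
    traces, and with general [t] for multiplicativity. *)
Lemma SLupper_square (t : K) : t != 0 ->
  exists x : SL2 K, forall b, (x * SLupper b = SLupper (t ^+ 2 * b) * x)%g.
Proof.
move=> t0; have dx : \det (mx22 t 0 0 t^-1) == 1.
  by rewrite det_mx22 mulfV // mulr0 subr0.
exists (MkSL2 dx) => b; apply: val_inj; rewrite /= !mulmx22.
by congr mx22; field.
Qed.

End SL2Elements.

(** Trace zero would give [M *m M = - 1%:M] by Cayley-Hamilton. With nonzero trace the off-diagonal
    entries vanish and the diagonal ones agree. So -1 is the only involution of SL(2,R). *)
Lemma sqr_eq1_det1 (R : realFieldType) (M : 'M[R]_2) :
  \det M = 1 -> M *m M = 1%:M -> M = 1%:M \/ M = - 1%:M.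
Proof.
have [a [b [c [d ->]]]] := mx22P M.
rewrite det_mx22 scalar_mx22 mulmx22 oppmx22 => dM /mx22_inj[e1 e2 e3 e4].
have s0 : a + d != 0.
  by apply/eqP => s0; have : d = - a; [lra | move=> ?; subst d; nra].
have b0 : b = 0 by apply: (mulfI s0); rewrite mulr0; lra.
have c0 : c = 0 by apply: (mulfI s0); rewrite mulr0; lra.
subst b c; have da : d = a.
  have : (a - d) * (a + d) = 0 by lra.
  by move/eqP; rewrite mulf_eq0 (negPf s0) orbF subr_eq0 => /eqP.
subst d; have : (a - 1) * (a + 1) = 0 by lra.
move/eqP; rewrite mulf_eq0 => /orP[]/eqP a1; [left|right].
  by congr mx22; lra.
by congr mx22; lra.
Qed.

(* If the eigenvalues x, 1/x satisfy {x^4, x^-4} = {x, 1/x}, then x^3 = 1 or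
   x^5 = 1. *)
Lemma mxtrace_exp15 (R : realFieldType) (M : 'M[R]_2) :
  \det M = 1 -> \tr (M ^+ 4) = \tr M -> \tr (M ^+ 15) = 2.
Proof.
move=> dM trM4; set t := \tr M in trM4 *.
have T2 (N : 'M[R]_2) : \det N = 1 -> \tr (N ^+ 2) = \tr N ^+ 2 - 2 :> R.
  move=> dN; rewrite mxtraceXn // expr1 expr0 mxtrace1; ring.
have T3 (N : 'M[R]_2) : \det N = 1 -> \tr (N ^+ 3) = \tr N ^+ 3 - 3 * \tr N :> R.
  by move=> dN; rewrite mxtraceXn // T2 // expr1; ring.
have T4 (N : 'M[R]_2) : \det N = 1 ->
    \tr (N ^+ 4) = \tr N ^+ 4 - 4 * \tr N ^+ 2 + 2 :> R.
  by move=> dN; rewrite mxtraceXn // T3 // T2 //; ring.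
have T5 (N : 'M[R]_2) : \det N = 1 ->
    \tr (N ^+ 5) = \tr N ^+ 5 - 5 * \tr N ^+ 3 + 5 * \tr N :> R.
  by move=> dN; rewrite mxtraceXn // T4 // T3 //; ring.
have d3 : \det (M ^+ 3) = 1 by rewrite !exprS expr0 mulr1 -!mulmxE !det_mulmx dM !mulr1.
(* The factors are the traces for an eigenvalue equal to 1, of order 3 and of order 5,
   respectively. *)
have : (t - 2) * ((t + 1) * (t ^+ 2 + t - 1)) = 0.
  by move: trM4; rewrite T4 // -/t; lra.
rewrite (_ : 15 = 3 * 5)%N // exprM T5 // T3 // -/t.
move/eqP; rewrite !mulf_eq0 => /or3P[]/eqP t0.
- by rewrite (_ : t = 2); [ring | lra].
- by rewrite (_ : t = -1); [ring | lra].
- pose q := t ^+ 3 - 3 * t.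
  have t2 : t ^+ 2 = 1 - t by lra.
  have t3 : t ^+ 3 = 2 * t - 1 by rewrite exprS t2 mulrBr mulr1 -expr2 t2; ring.
  have -> : t ^+ 3 - 3 * t = - 1 - t by rewrite t3; ring.
  transitivity
    (- t ^+ 5 - 5 * t ^+ 4 - 5 * t ^+ 3 + 5 * t ^+ 2 + 5 * t - 1 : R).
    by ring.
  rewrite (_ : t ^+ 5 = t ^+ 3 * t ^+ 2) 1?(_ : t ^+ 4 = (t ^+ 2) ^+ 2); [|ring|ring].
  rewrite t3 t2; transitivity (-3 * t ^+ 2 + -3 * t + 5 : R); first by ring.
  rewrite t2; ring.
Qed.

(** * Characteristic zero, and traces of the images of transvections *)

Section Embedding.
Variables (K : fieldType) (R : realFieldType) (phi : SL2 K -> 'M[R]_2).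
Hypothesis phiM : forall x y, phi (x * y)%g = phi x *m phi y.
Hypothesis det_phi : forall x, \det (phi x) = 1.
Hypothesis phi_inj : injective phi.

Let phi_unit x : phi x \in unitmx.
Proof. by rewrite unitmxE det_phi unitr1. Qed.

Lemma embedding1 : phi 1%g = 1%:M.
Proof. by rewrite -[LHS](mulKmx (phi_unit 1%g)) -phiM mulg1 mulVmx. Qed.

Lemma embedding_involution x : (x * x = 1)%g -> x != 1%g -> phi x = - 1%:M.
Proof.
move=> xx x1; have := phiM x x; rewrite xx embedding1 => /esym.
case/(sqr_eq1_det1 (det_phi x)) => // p1; case/eqP: x1.
by apply: phi_inj; rewrite p1 embedding1.
Qed.

(** In characteristic 2 the upper and lower transvections are two distinct involutions, while
    SL(2,R) has only one. *)
Lemma embedding_pchar2 : 2 != 0 :> K.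
Proof.
apply/eqP => K2; have K11 : 1 + 1 = 0 :> K by rewrite -K2.
have U1 : phi (SLupper 1) = - 1%:M.
  apply: embedding_involution; first by rewrite -SLupperD K11 SLupper0.
  apply/eqP => /(congr1 val); rewrite /= scalar_mx22 => /mx22_inj[_ /eqP].
  by rewrite oner_eq0.
have L1 : phi (SLlower 1) = - 1%:M.
  apply: embedding_involution; first by rewrite -SLlowerD K11 SLlower0.
  apply/eqP => /(congr1 val); rewrite /= scalar_mx22 => /mx22_inj[_ _ /eqP].
  by rewrite oner_eq0.
have /phi_inj/(congr1 val) : phi (SLupper 1) = phi (SLlower 1) by rewrite U1 L1.
by move=> /mx22_inj[_ /eqP]; rewrite oner_eq0.
Qed.

(* The quaternion relations hold in SL2(K), but not in SL2(R), as soon as -1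
   is a sum of two squares in K. *)
Lemma embedding_sum_squares (a b : K) : a ^+ 2 + b ^+ 2 != - 1.
Proof.
(* This matrix has trace zero and determinant [- (a ^+ 2 + b ^+ 2) = 1], so it squares to -1; with
   the Weyl element it generates the quaternion relations. *)
apply/eqP => ab; have dx : \det (mx22 a b b (- a)) == 1.
  by rewrite det_mx22 -[X in _ == X]opprK -ab; apply/eqP; ring.
pose x : SL2 K := MkSL2 dx; pose w := SLweyl K.
have dm : \det (- 1%:M : 'M[K]_2) == 1.
  by rewrite scalar_mx22 oppmx22 det_mx22; apply/eqP; ring.
pose m : SL2 K := MkSL2 dm.
have vm : val m = mx22 (-1) 0 0 (-1) by rewrite /= scalar_mx22 oppmx22 oppr0.
have phim : phi m = - 1%:M.
  apply: embedding_involution.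
    by apply: val_inj; rewrite /= mulNmx mulmxN opprK mulmx1.
  apply/eqP => /(congr1 val); rewrite vm /= scalar_mx22 => /mx22_inj[/eqP].
  by rewrite eq_sym -addr_eq0 (negPf embedding_pchar2).
have vx : val x = mx22 a b b (- a) by [].
have vw : val w = mx22 0 1 (-1) 0 by [].
have xx : (x * x)%g = m.
  by apply: val_inj; rewrite SL2_valM vm vx mulmx22; congr mx22; rewrite -?ab; ring.
have ww : (w * w)%g = m.
  by apply: val_inj; rewrite SL2_valM vm vw mulmx22; congr mx22; ring.
have xw : (x * w)%g = (m * (w * x))%g.
  by apply: val_inj; rewrite !SL2_valM vm vx vw !mulmx22; congr mx22; ring.
apply: (@no_anticommuting_roots R (phi x) (phi w)).
- by rewrite -phiM xx.
- by rewrite -phiM ww.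
- by rewrite -!phiM xw phiM phim mulNmx mul1mx.
Qed.

Lemma embedding_pchar0 : [pchar K] =i pred0.
Proof.
move=> p; apply/negP => pK; have pp := pcharf_prime pK; have p0 := pcharf0 pK.
have [p2|op] := even_prime pp.
  by case/eqP: embedding_pchar2; rewrite -p0 p2.
have [x [y xy]] := minus_one_sum_squares pp op.
(* Natural representatives carry the relation from ['F_p] to [K]: it becomes divisibility by [p],
   which is also the characteristic of [K]. *)
have : (val x ^ 2 + val y ^ 2 + 1)%:R = 0 :> 'F_p.
  rewrite !natrD !natrX; have xE (z : 'F_p) : (val z)%:R = z.
    exact: natr_Zp.
  by rewrite !xE xy addNr.
move/eqP; rewrite -(dvdn_pcharf (pchar_Fp pp)) (dvdn_pcharf pK) => /eqP.
rewrite !natrD !natrX => /eqP; rewrite addr_eq0.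
by rewrite (negPf (embedding_sum_squares _ _)).
Qed.

Lemma embedding_upper_trace b : \tr (phi (SLupper b)) = 2.
Proof.
have /pcharf0P K0 := embedding_pchar0.
have powE c n : phi (SLupper (c *+ n)) = phi (SLupper c) ^+ n.
  elim: n => [|n IH]; first by rewrite mulr0n SLupper0 embedding1.
  by rewrite mulrS SLupperD phiM IH exprS -mulmxE.
(* Dividing by 15, which is nonzero in characteristic 0, makes the given image [M ^+ 15], to which
   [mxtrace_exp15] applies. *)
pose c := b / 15%:R; set M := phi (SLupper c).
have -> : b = c *+ 15 by rewrite -mulr_natr /c divfK // K0.
rewrite powE -/M.
have dM : \det M = 1 by exact: det_phi.
have trM4 : \tr (M ^+ 4) = \tr M.
  have [x xE] := SLupper_square embedding_pchar2.
  have e := xE c; have e4 : 2 ^+ 2 * c = c *+ 4 by rewrite -[RHS]mulr_natl; ring.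
  rewrite -powE -e4.
  have /(congr1 (mulmx^~ (invmx (phi x)))) := congr1 phi e.
  rewrite !phiM mulmxK // => <-.
  by rewrite mxtrace_mulC mulKmx.
exact: mxtrace_exp15.
Qed.

End Embedding.

(** * Simultaneous normal form of two non-commuting unipotent matrices *)

Section UnipotentPair.
Variable F : fieldType.
Implicit Types (M N P U V : 'M[F]_2) (v : 'cV[F]_2).

Lemma mulmx_col2 m n (M : 'M[F]_(m, 2)) (N : 'M[F]_(2, n)) i j :
  (M *m N) i j = M i 0 * N 0 j + M i 1 * N 1 j.
Proof.
rewrite !mxE !big_ord_recl big_ord0 addr0.
by congr (_ + M i _ * N _ j); apply: val_inj.
Qed.

Lemma col2P v1 v2 : v1 0 0 = v2 0 0 -> v1 1 0 = v2 1 0 -> v1 = v2.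
Proof. by move=> e0 e1; apply/colP; apply: ord2P. Qed.

Lemma col2_neq0 v : v != 0 -> v 0 0 != 0 \/ v 1 0 != 0.
Proof.
move=> v0; have [e0|] := eqVneq (v 0 0) 0; last by left.
by right; apply: contra v0 => /eqP e1; apply/eqP/col2P; rewrite mxE.
Qed.

(** Two rows that annihilate the same nonzero column are proportional. *)
Lemma orthogonal_col2 v x y x' y' : v != 0 ->
  x * v 0 0 + y * v 1 0 = 0 -> x' * v 0 0 + y' * v 1 0 = 0 -> x * y' = x' * y.
Proof.
move=> /col2_neq0 + e e'; set p := v 0 0 in e e' *; set q := v 1 0 in e e' *.
case=> h; apply/eqP; rewrite -subr_eq0; apply/eqP/(mulfI h); rewrite mulr0.
  transitivity ((x * p + y * q) * y' - (x' * p + y' * q) * y); first by ring.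
  by rewrite e e' !mul0r subrr.
transitivity ((x' * p + y' * q) * x - (x * p + y * q) * x'); first by ring.
by rewrite e e' !mul0r subrr.
Qed.

(** [U - 1] and [V - 1] have trace zero and kill [v], hence are proportional; [e1], [e2] and [e3]
    are the corresponding minors. *)
Lemma unipotent_commute U V v :
    \tr U = 2 -> \tr V = 2 -> v != 0 -> U *m v = v -> V *m v = v ->
  U *m V = V *m U.
Proof.
have [a [b [c [d ->]]]] := mx22P U; have [a' [b' [c' [d' ->]]]] := mx22P V.
rewrite !mxtrace22 => tU tV v0 /colP Uv /colP Vv.
have ea : a = 2 - d by rewrite -tU addrK.
have ea' : a' = 2 - d' by rewrite -tV addrK.
have := (Uv 0, Uv 1, (Vv 0, Vv 1)); rewrite !mulmx_col2 !mxE /=.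
set p := v 0 0; set q := v 1 0 => -[[u0 u1] [w0 w1]].
have {}u0 : (1 - d) * p + b * q = 0 by rewrite -(subrr p) -{2}u0 ea; ring.
have {}u1 : c * p + (d - 1) * q = 0 by rewrite -(subrr q) -{2}u1; ring.
have {}w0 : (1 - d') * p + b' * q = 0 by rewrite -(subrr p) -{2}w0 ea'; ring.
have {}w1 : c' * p + (d' - 1) * q = 0 by rewrite -(subrr q) -{2}w1; ring.
have e1 := orthogonal_col2 v0 u0 w0.
have e2 := orthogonal_col2 v0 u1 w1.
have e3 : b * c' = b' * c.
  have [h|h] := col2_neq0 v0; apply/eqP; rewrite -subr_eq0; apply/eqP.
    apply: (mulfI h); rewrite mulr0.
    transitivity (b * (c' * p + (d' - 1) * q) - b' * (c * p + (d - 1) * q)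
       - ((1 - d') * b - (1 - d) * b') * q * -1); first by rewrite -/p; ring.
    by rewrite u1 w1 e1 subrr; ring.
  apply: (mulfI h); rewrite mulr0.
  transitivity (((1 - d) * p + b * q) * c' - ((1 - d') * p + b' * q) * c
       - (c * (d' - 1) - c' * (d - 1)) * p); first by rewrite -/q; ring.
  by rewrite u0 w0 e2 subrr; ring.
rewrite !mulmx22 ea ea'; congr mx22.
- by rewrite e3; ring.
- transitivity ((1 - d) * b' + b' + b * d'); first by ring.
  by rewrite e1; transitivity (b + (1 - d) * b' + b' * d); [|rewrite e1]; ring.
- transitivity (c - c * (d' - 1) + d * c'); first by ring.
  by rewrite e2; transitivity (c' - c * (d' - 1) + d' * c); [|rewrite e2]; ring.
- transitivity (b' * c + d * d'); [by ring | rewrite -e3; ring].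
Qed.

(** The basis consists of [w = U v - v], fixed by [U] because [(U - 1)^2 = 0], and of [v], fixed by
    [V]. Then [U] sends [v] to [w + v], and trace 2 makes [V] lower unipotent. *)
Lemma unipotent_pair U V :
    \det U = 1 -> \det V = 1 -> \tr U = 2 -> \tr V = 2 ->
    U *m V != V *m U ->
  exists2 P, P \in unitmx &
    U *m P = P *m upper 1 /\ exists t, V *m P = P *m lower t.
Proof.
move=> dU dV tU tV UV.
have [v v0 Vv] := unipotent_fixed_vector dV tV.
have [w wdef] : exists w, w = U *m v - v by eexists.
have wE i : w i 0 = U i 0 * v 0 0 + U i 1 * v 1 0 - v i 0.
  by rewrite wdef !mxE; congr (_ - _); rewrite -mulmx_col2 mxE.
pose P := mx22 (w 0 0) (v 0 0) (w 1 0) (v 1 0).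
(* If [w] and [v] were dependent, [v] would be an eigenvector of [U], whose only eigenvalue is 1;
   both matrices would fix [v] and so commute. *)
have dP : \det P != 0.
  apply: contra UV => /eqP dP; apply/eqP/(unipotent_commute tU tV v0) => //.
  move: dP; rewrite det_mx22 !wE {w wdef wE P}.
  move: dU tU; have [a [b [c [d ->]]]] := mx22P U.
  rewrite det_mx22 mxtrace22 !mxE /= => dU tU.
  have ea : a = 2 - d by rewrite -tU addrK.
  set p := v 0 0; set q := v 1 0 => dP.
  pose D := (a * p + b * q - p) * q - p * (c * p + d * q - q).
  have {}dP : D = 0 := dP.
  have bc : b * c = - (1 - d) ^+ 2.
    by transitivity (a * d - 1); [rewrite -dU | rewrite ea]; ring.
  have sq0 (x : F) : x ^+ 2 = 0 -> x = 0 by move/eqP; rewrite sqrf_eq0 => /eqP.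
  (* The coordinates of [U v - v] have squares [b * D] and [- c * D], by [bc], and therefore
     vanish. *)
  apply: col2P; rewrite mulmx_col2 !mxE /= -/p -/q; apply/eqP;
    rewrite -subr_eq0; apply/eqP/sq0.
    transitivity (b * D); last by rewrite dP mulr0.
    transitivity (p ^+ 2 * ((1 - d) ^+ 2 + b * c) + b * D).
      by rewrite /D ea; ring.
    by rewrite bc; ring.
  transitivity (- c * D); last by rewrite dP mulr0.
  transitivity (q ^+ 2 * ((1 - d) ^+ 2 + b * c) - c * D).
    by rewrite /D ea; ring.
  by rewrite bc; ring.
have uP : P \in unitmx by rewrite unitmxE unitfE.
exists P => //; split.
  have Uw : U *m w = w.
    have := mulmx_traceZ dU; rewrite tU => UU.
    rewrite wdef mulmxBr mulmxA UU mulmxBl mul1mx -scalemxAl scaler_nat mulr2n.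
    by rewrite -addrA -opprD opprD addrACA subrr addr0.
  have Uwi i : U i 0 * w 0 0 + U i 1 * w 1 0 = w i 0 by rewrite -mulmx_col2 Uw.
  have Uv i : U i 0 * v 0 0 + U i 1 * v 1 0 = w i 0 + v i 0 by rewrite wE subrK.
  apply/matrixP => i; apply: ord2P; rewrite !mulmx_col2 /P /upper !mxE /=.
    by rewrite Uwi; move: i; apply: ord2P; rewrite /= ?mulr1 ?mulr0 ?addr0.
  by rewrite Uv; move: i; apply: ord2P; rewrite /= ?mulr1 ?mulr0 ?addr0.
have [a [b [c [d e]]]] := mx22P (invmx P *m V *m P).
have VP : V *m P = P *m mx22 a b c d by rewrite -e !mulmxA mulmxV // mul1mx.
have tr : a + d = 2.
  by rewrite -(mxtrace22 a b c d) -e mxtrace_mulC mulmxA mulmxV // mul1mx.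
have [b0 d1] : b = 0 /\ d = 1.
  have : invmx P *m V *m P *m (\col_j (j == 1)%:R) = \col_j (j == 1)%:R.
    rewrite -mulmxA.
    have -> : P *m (\col_j (j == 1)%:R) = v.
      by apply: col2P; rewrite mulmx_col2 !mxE /= ?mulr0 ?mulr1 ?add0r.
    rewrite -mulmxA Vv.
    have {1}-> : v = P *m (\col_j (j == 1)%:R).
      by apply: col2P; rewrite mulmx_col2 !mxE /= ?mulr0 ?mulr1 ?add0r.
    by rewrite mulKmx.
  rewrite e => /colP h; have := (h 0, h 1); rewrite !mulmx_col2 !mxE /=.
  by rewrite !mulr0 !mulr1 !add0r => -[].
exists c; rewrite VP b0 d1 (_ : a = 1) //; rewrite d1 in tr.
by apply: (addIr 1); rewrite tr.
Qed.

End UnipotentPair.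

Lemma commute_upper1 (F : fieldType) (M : 'M[F]_2) :
  M *m upper 1 = upper 1 *m M -> exists a b, M = mx22 a b 0 a.
Proof.
have [a [b [c [d ->]]]] := mx22P M; rewrite !mulmx22 => /mx22_inj[e1 e2 _ _].
move: e1 e2; rewrite !(mulr1, mul1r, mulr0, mul0r, addr0) => e1 e2.
exists a, b; congr mx22; first by apply: (addrI a); rewrite addr0 -e1.
by apply: (addrI b); rewrite -e2 addrC.
Qed.

(** * The field morphism carried by a normalized embedding *)

Section NormalizedEmbedding.
Variables (K : fieldType) (R : realFieldType) (phi : SL2 K -> 'M[R]_2) (t : R).
Hypothesis phiM : forall x y, phi (x * y)%g = phi x *m phi y.
Hypothesis det_phi : forall x, \det (phi x) = 1.
Hypothesis phi_inj : injective phi.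
Hypothesis phi_upper1 : phi (SLupper 1) = upper 1.
Hypothesis phi_lower1 : phi (SLlower 1) = lower t.

Let phi1 : phi 1%g = 1%:M.
Proof. exact: embedding1. Qed.

Let f (b : K) : R := phi (SLupper b) 0 1.

Let phi_upper b : phi (SLupper b) = upper (f b).
Proof.
have [a [c e]] : exists a c, phi (SLupper b) = mx22 a c 0 a.
  by apply: commute_upper1; rewrite -phi_upper1 -!phiM -!SLupperD addrC.
have := embedding_upper_trace phiM det_phi phi_inj b.
rewrite /f e mxtrace22 => tr; rewrite (_ : a = 1) ?mxE //; lra.
Qed.

Let fD b c : f (b + c) = f b + f c.
Proof.
have := congr1 phi (SLupperD b c); rewrite phiM !phi_upper mulmx22.
by case/mx22_inj=> _ -> _ _; ring.
Qed.

Let f1 : f 1 = 1.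
Proof. by rewrite /f phi_upper1 mxE. Qed.

Let f0 : f 0 = 0.
Proof. by apply: (addrI (f 0)); rewrite -fD !addr0. Qed.

Let fN b : f (- b) = - f b.
Proof. by apply: (addrI (f b)); rewrite -fD !subrr f0. Qed.

Let phi_lowerN1 : phi (SLlower (-1)) = lower (- t).
Proof.
have : phi (SLlower (-1)) *m lower t = 1%:M.
  by rewrite -phi_lower1 -phiM -SLlowerD addNr SLlower0 phi1.
have [a [b [c [d ->]]]] := mx22P (phi (SLlower (-1))).
rewrite mulmx22 scalar_mx22 => /mx22_inj[e1 e2 e3 e4].
by congr mx22; nra.
Qed.

(** The upper right entry of the relation [SLweyl_upper] at 1 reads [3 - 2 * t = 2 - t]. *)
Let t1 : t = 1.
Proof.
have := congr1 phi (SLweyl_upper (1 : K)).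
rewrite SLweylE !phiM phi_upper1 phi_lowerN1 !mulmx22 => /mx22_inj[_ e _ _].
lra.
Qed.

Lemma normalized_weyl : phi (SLweyl K) = weyl R.
Proof.
rewrite SLweylE !phiM phi_upper1 phi_lowerN1 t1 !mulmx22.
by congr mx22; ring.
Qed.

Lemma normalized_lower c : phi (SLlower c) = lower (f c).
Proof.
have := congr1 phi (SLweyl_upper (- c)); rewrite opprK !phiM normalized_weyl.
rewrite phi_upper fN.
have [x [y [z [q ->]]]] := mx22P (phi (SLlower c)).
by rewrite !mulmx22 => /mx22_inj[e1 e2 e3 e4]; congr mx22; lra.
Qed.

(** The image of the diagonal element is upper triangular, so conjugation by it multiplies [f] by
    the constant [a / d]; taking [b = 1] identifies this constant as [f (s ^+ 2)]. *)
Let f_square s b : s != 0 -> f (s ^+ 2 * b) = f (s ^+ 2) * f b.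
Proof.
move=> s0; have [x xE] := SLupper_square s0.
have [a [c [g [d e]]]] := mx22P (phi x).
have h b' : a * f b' + c = c + f (s ^+ 2 * b') * d /\ g = 0.
  have := congr1 phi (xE b'); rewrite !phiM !phi_upper e.
  have := congr1 phi (xE 1); rewrite !phiM !phi_upper e f1.
  rewrite !mulmx22 => /mx22_inj[_ _ _ e4] /mx22_inj[_ e2 _ _].
  split; lra.
have [e1 g0] := h 1; have [eb _] := h b.
have := det_phi x; rewrite e det_mx22 g0 => ad.
have d0 : d != 0 by apply/eqP => d0; have := oner_neq0 R; rewrite -ad d0 !mulr0 subrr eqxx.
rewrite f1 mulr1 in e1 eb.
apply: (mulIf d0).
have ea : a = f (s ^+ 2) * d by lra.
rewrite ea in eb; lra.
Qed.

Let fM b c : f (b * c) = f b * f c.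
Proof.
have sq s x : f (s ^+ 2 * x) = f (s ^+ 2) * f x.
  have [->|] := eqVneq s 0; last exact: f_square.
  by rewrite expr0n /= !mul0r f0 mul0r.
have K2 := embedding_pchar2 phiM det_phi phi_inj.
(* As 2 is invertible, every element is a difference of two squares, so additivity extends
   multiplicativity from squares to all factors. *)
have -> : b = ((b + 1) / 2) ^+ 2 - ((b - 1) / 2) ^+ 2 by field.
move: (_ / 2) (_ / 2) => x y; rewrite mulrBl !fD !fN !sq.
rewrite -[x ^+ 2]mulr1 -[y ^+ 2]mulr1 !sq f1 !mulr1; ring.
Qed.

Lemma normalized_embedding : exists F : {rmorphism K -> R},
  [/\ forall b, phi (SLupper b) = upper (F b),
      forall b, phi (SLlower b) = lower (F b) &
      phi (SLweyl K) = weyl R].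
Proof.
have fB : zmod_morphism f by move=> x y; rewrite fD fN.
pose fA := GRing.isZmodMorphism.Build _ _ f fB.
pose fMM := GRing.isMonoidMorphism.Build _ _ f (conj f1 fM).
pose F : {rmorphism K -> R} := HB.pack f fA fMM.
exists F; split=> [b|b|]; first exact: phi_upper.
  exact: normalized_lower.
exact: normalized_weyl.
Qed.

End NormalizedEmbedding.

Lemma SL2_embedding (K : fieldType) (R : realFieldType) (phi : SL2 K -> 'M[R]_2) :
    (forall x y, phi (x * y)%g = phi x *m phi y) ->
    (forall x, \det (phi x) = 1) -> injective phi ->
  exists (P : 'M[R]_2) (F : {rmorphism K -> R}), P \in unitmx /\
  [/\ forall b, invmx P *m phi (SLupper b) *m P = upper (F b),
      forall b, invmx P *m phi (SLlower b) *m P = lower (F b) &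
      invmx P *m phi (SLweyl K) *m P = weyl R].
Proof.
move=> phiM dphi phi_inj.
have trU := embedding_upper_trace phiM dphi phi_inj.
(* The Weyl element conjugates [SLupper (-1)] to [SLlower 1]. *)
have trL : \tr (phi (SLlower 1)) = 2.
  rewrite -(trU (-1)); have := congr1 phi (SLweyl_upper (-1 : K)).
  rewrite opprK !phiM => e.
  have uw : phi (SLweyl K) \in unitmx by rewrite unitmxE dphi unitr1.
  by rewrite -[phi (SLlower 1)](mulmxK uw) -e mxtrace_mulC mulKmx.
have nc :
    phi (SLupper 1) *m phi (SLlower 1) != phi (SLlower 1) *m phi (SLupper 1).
  rewrite -!phiM (inj_eq phi_inj); apply/eqP => /(congr1 val).
  rewrite /= !mulmx22 => /mx22_inj[/eqP].
  by rewrite !mulr0 !mulr1 addr0 -subr_eq0 addrC addKr oner_eq0.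
have [P uP [eU [t eL]]] := unipotent_pair (dphi _) (dphi _) (trU 1) trL nc.
pose psi x := invmx P *m phi x *m P.
have psiM x y : psi (x * y)%g = psi x *m psi y.
  by rewrite /psi phiM !mulmxA mulmxK.
have dpsi x : \det (psi x) = 1.
  by rewrite /psi !det_mulmx det_inv dphi mulr1 mulVr // -unitmxE.
have psi_inj : injective psi.
  move=> x y /(congr1 (fun M => P *m M *m invmx P)).
  by rewrite /psi !mulmxA mulmxV // !mul1mx !mulmxK // => /phi_inj.
have pU : psi (SLupper 1) = upper 1 by rewrite /psi -mulmxA eU mulKmx.
have pL : psi (SLlower 1) = lower t by rewrite /psi -mulmxA eL mulKmx.
have [F hF] := normalized_embedding psiM dpsi psi_inj pU pL.
by exists P, F.
Qed.

(** * Alternating forms and bivectors of the plane *)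

Lemma wedgeC (V : lmodType rat) (v w : V) : wedge w v = - wedge v w.
Proof.
apply/eqP; rewrite -addr_eq0; apply/eqP.
by have := wedge_alt (v + w); rewrite wedgeDl !wedgeDr !wedge_alt add0r addr0 addrC.
Qed.

Section ExtSquareMaps.
Variables V W : lmodType rat.

Lemma ext_sq_linear_eq (U : lmodType rat) (f g : {linear ext_sq V -> U}) :
  (forall v w, f (wedge v w) = g (wedge v w)) -> f =1 g.
Proof.
move=> fg; apply: ext_sq_ind => [|q v w x IH]; first by rewrite !linear0.
by rewrite !linearP fg IH.
Qed.

(* The polarization of the quadratic map [p |-> ext_map p]; see ext_mapD. *)
Definition ext_mix (p q : V -> W) : ext_sq V -> ext_sq W :=
  ext_lift (fun v w => wedge (p v) (q w) + wedge (q v) (p w)).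

Section Mix.
Variables p q : {linear V -> W}.

Let mix_alt v : wedge (p v) (q v) + wedge (q v) (p v) = 0.
Proof. by rewrite [X in _ + X]wedgeC subrr. Qed.
Let mix_linl w : linear (fun v => wedge (p v) (q w) + wedge (q v) (p w)).
Proof.
by move=> a x y; rewrite !linearP !wedgeDl !wedgeZl scalerDr addrACA.
Qed.
Let mix_linr v : linear (fun w => wedge (p v) (q w) + wedge (q v) (p w)).
Proof.
by move=> a x y; rewrite !linearP !wedgeDr !wedgeZr scalerDr addrACA.
Qed.

Lemma ext_mixE v w :
  ext_mix p q (wedge v w) = wedge (p v) (q w) + wedge (q v) (p w).
Proof. exact: (ext_liftE mix_alt mix_linl mix_linr). Qed.

Lemma ext_mix_linear : linear (ext_mix p q).
Proof. exact: (ext_lift_linear mix_alt mix_linl mix_linr). Qed.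

HB.instance Definition _ :=
  GRing.isLinear.Build rat (ext_sq V) (ext_sq W) _ (ext_mix p q) ext_mix_linear.

Lemma ext_mapD x :
  ext_map (p \+ q) x = ext_map p x + ext_map q x + ext_mix p q x.
Proof.
apply: (ext_sq_linear_eq (g := ext_map p \+ ext_map q \+ ext_mix p q)) => v w /=.
by rewrite !ext_mapE ext_mixE /= wedgeDl !wedgeDr [LHS](AC (2*2) ((1*4)*(2*3))).
Qed.

End Mix.

Lemma eq_ext_map (p q : V -> W) : p =1 q -> ext_map p =1 ext_map q.
Proof. by move=> /funext ->. Qed.

Lemma eq_ext_mix (p q p' q' : V -> W) :
  p =1 p' -> q =1 q' -> ext_mix p q =1 ext_mix p' q'.
Proof. by move=> /funext -> /funext ->. Qed.

Lemma ext_mixDl (p p' q : {linear V -> W}) x :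
  ext_mix (p \+ p') q x = ext_mix p q x + ext_mix p' q x.
Proof.
apply: (ext_sq_linear_eq (g := ext_mix p q \+ ext_mix p' q)) => v w /=.
by rewrite !ext_mixE /= wedgeDl wedgeDr addrACA.
Qed.

Lemma ext_mixC (p q : {linear V -> W}) : ext_mix p q =1 ext_mix q p.
Proof.
apply: (ext_sq_linear_eq (f := ext_mix p q) (g := ext_mix q p)) => v w.
by rewrite /= !ext_mixE addrC.
Qed.

Lemma ext_mixxx (p : {linear V -> W}) x : ext_mix p p x = ext_map p x *+ 2.
Proof.
rewrite mulr2n; apply: (ext_sq_linear_eq (g := ext_map p \+ ext_map p)) => v w.
by rewrite /= ext_mixE ext_mapE.
Qed.

Lemma ext_mixNr (p q r : {linear V -> W}) x :
  (forall v, r v = - q v) -> ext_mix p r x = - ext_mix p q x.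
Proof.
move=> rN; apply/eqP; rewrite -addr_eq0; apply/eqP.
apply: (ext_sq_linear_eq (f := ext_mix p r \+ ext_mix p q) (g := \0)) => v w /=.
rewrite !ext_mixE !rN -!scaleN1r.
by rewrite wedgeZl wedgeZr -scalerDr !scaleN1r addNr.
Qed.

End ExtSquareMaps.

Section ExtSquareComp.
Variables U V W : lmodType rat.

Lemma ext_map_comp (f : {linear V -> W}) (g : {linear U -> V}) x :
  ext_map (f \o g) x = ext_map f (ext_map g x).
Proof.
apply: (ext_sq_linear_eq (g := ext_map f \o ext_map g)) => v w /=.
by rewrite !ext_mapE.
Qed.

Lemma ext_mix_map (p q : {linear V -> W}) (g : {linear U -> V}) x :
  ext_mix (p \o g) (q \o g) x = ext_mix p q (ext_map g x).
Proof.
apply: (ext_sq_linear_eq (g := ext_mix p q \o ext_map g)) => v w /=.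
by rewrite !ext_mixE ext_mapE ext_mixE.
Qed.

Lemma ext_mix_mix (f g : {linear V -> W}) (p q : {linear U -> V}) x :
  ext_mix f g (ext_mix p q x) =
  ext_mix (f \o p) (g \o q) x + ext_mix (f \o q) (g \o p) x.
Proof.
apply: (ext_sq_linear_eq (f := ext_mix f g \o ext_mix p q)
  (g := ext_mix (f \o p) (g \o q) \+ ext_mix (f \o q) (g \o p))) => v w /=.
rewrite !ext_mixE linearD /= !ext_mixE /=.
by rewrite addrACA -!addrA; congr (_ + _); rewrite addrA addrC.
Qed.

End ExtSquareComp.

(** * Periodic directions and the action of matrices on bivectors of the plane *)

Section PlaneMaps.
Variable R : realType.
Implicit Types (s : R) (J : ext_sq (plane R)) (v : 'cV[R]_2) (g : 'M[R]_2).

Definition coord (i : 'I_2) (v : plane R) : line R := (v : 'cV[R]_2) i 0.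
Lemma coord_linear i : linear (coord i).
Proof. by move=> q v w; rewrite /coord !mxE. Qed.

HB.instance Definition _ i :=
  GRing.isLinear.Build rat (plane R) (line R) _ (coord i) (coord_linear i).

Definition axis (i : 'I_2) (x : line R) : plane R :=
  (x : R) *: (delta_mx i 0 : 'cV[R]_2).
Lemma axis_linear i : linear (axis i).
Proof. by move=> q x y; rewrite /axis scalerDl -scalerA. Qed.

HB.instance Definition _ i :=
  GRing.isLinear.Build rat (line R) (plane R) _ (axis i) (axis_linear i).

Definition line_scale s (x : line R) : line R := s * (x : R).
Lemma line_scale_linear s : linear (line_scale s).
Proof. by move=> q x y; rewrite /line_scale mulrDr; congr (_ + _); exact: mulrCA. Qed.

HB.instance Definition _ s :=
  GRing.isLinear.Build rat (line R) (line R) _ (line_scale s) (line_scale_linear s).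

Lemma cross_mulmx g v w : cross (g *m v) (g *m w) = \det g * cross v w.
Proof.
have [a [b [c [d ->]]]] := mx22P g.
by rewrite /cross !mulmx_col2 !mxE /= det_mx22; ring.
Qed.

Lemma norm_neq0 v : v != 0 -> Num.sqrt (v 0 0 ^+ 2 + v 1 0 ^+ 2) != 0.
Proof.
move=> v0; rewrite sqrtr_eq0 -ltNge.
rewrite lt_def paddr_eq0 ?sqr_ge0 // !sqrf_eq0 addr_ge0 ?sqr_ge0 // andbT.
by rewrite negb_and; exact/orP/col2_neq0.
Qed.

(** Functionals with the same kernel differ by an invertible scaling of the line, which acts
    functorially on the exterior square. The normalization of the orthogonal projection can thus be
    dropped. *)
Lemma SAF_eq0 (p : {linear plane R -> line R}) v (k : R) J :
    v != 0 -> k != 0 -> (forall w, p w = k * cross v w) ->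
  SAF v J = 0 <-> ext_map p J = 0.
Proof.
move=> /norm_neq0; set N := Num.sqrt _ => N0 k0 pE; split => J0.
  have e : p =1 line_scale (k * N) \o ortho_proj v.
    by move=> w; rewrite pE /= /line_scale /ortho_proj -/N; field.
  by rewrite (eq_ext_map e) ext_map_comp [X in ext_map _ X]J0 linear0.
have e : ortho_proj v =1 line_scale (k * N)^-1 \o p.
  by move=> w; rewrite /= /line_scale pE /ortho_proj -/N; field; rewrite N0.
by rewrite /SAF (eq_ext_map e) ext_map_comp J0 linear0.
Qed.

(** Since [cross] is multiplied by [\det g], the projection along the moved direction, composed with
    [g], is proportional to the projection along [v]. *)
Lemma periodic_act J v g (c : R) : g \in unitmx -> c != 0 ->
  periodic_direction J v -> periodic_direction (bivector_act g J) (c *: (g *m v)).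
Proof.
move=> ug c0 [v0 J0]; have w0 : c *: (g *m v) != 0.
  rewrite scaler_eq0 (negPf c0) /=; apply: contra v0 => /eqP gv.
  by rewrite -(mulKmx ug v) gv mulmx0.
split => //; rewrite /SAF /bivector_act -ext_map_comp.
have dg : \det g != 0 by rewrite -unitfE -unitmxE.
set N := Num.sqrt ((c *: (g *m v)) 0 0 ^+ 2 + (c *: (g *m v)) 1 0 ^+ 2).
apply/(@SAF_eq0 _ v (c * \det g / N)) => //.
  by rewrite !mulf_neq0 ?invr_eq0 ?norm_neq0.
move=> w; rewrite /= /ortho_proj /plane_act.
have -> : cross (c *: (g *m v)) (g *m w) = c * \det g * cross v w.
  by rewrite -mulrA -cross_mulmx /cross !mxE; ring.
by rewrite mulrAC.
Qed.

Lemma plane_act_mx22 (a b c d : R) w :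
  plane_act (mx22 a b c d) w = vec2 (a * w 0 0 + b * w 1 0) (c * w 0 0 + d * w 1 0).
Proof. by apply: col2P; rewrite /plane_act mulmx_col2 !mxE. Qed.

Lemma periodic_horizontal J :
  periodic_direction J (vec2 1 0) <-> ext_map (coord 1) J = 0.
Proof.
have v0 : vec2 1 0 != 0 :> 'cV[R]_2.
  by apply/eqP => /colP/(_ 0); rewrite !mxE => /eqP; rewrite oner_eq0.
rewrite -(@SAF_eq0 (coord 1) (vec2 1 0) 1 J v0 (oner_neq0 _)) => [|w].
  by split=> [[]|].
by rewrite /= /coord /cross !mxE /=; ring.
Qed.

Lemma periodic_vertical J :
  periodic_direction J (vec2 0 1) <-> ext_map (coord 0) J = 0.
Proof.
have v0 : vec2 0 1 != 0 :> 'cV[R]_2.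
  by apply/eqP => /colP/(_ 1); rewrite !mxE => /eqP; rewrite oner_eq0.
rewrite -(@SAF_eq0 (coord 0) (vec2 0 1) (-1) J v0); first by split=> [[]|].
  by rewrite oppr_eq0 oner_eq0.
by move=> w; rewrite /= /coord /cross !mxE /=; ring.
Qed.

(** The functional [y - s x] kills the direction of slope [s]. When its square is expanded by
    [ext_mapD], the pure terms vanish and only the mixed one remains. *)
Lemma periodic_slope J s : ext_map (coord 0) J = 0 -> ext_map (coord 1) J = 0 ->
  periodic_direction J (vec2 1 s) <->
  ext_mix (coord 1) (line_scale s \o coord 0) J = 0.
Proof.
move=> J0 J1; have v0 : vec2 1 s != 0.
  by apply/eqP => /colP/(_ 0); rewrite !mxE => /eqP; rewrite oner_eq0.
have -> : ext_mix (coord 1) (line_scale s \o coord 0) J =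
    - ext_map (coord 1 \+ (line_scale (- s) \o coord 0)) J.
  rewrite ext_mapD J1 ext_map_comp J0 linear0 !add0r; apply: ext_mixNr => w /=.
  by rewrite /line_scale mulNr opprK.
have h : SAF (vec2 1 s) J = 0 <->
    ext_map (coord 1 \+ (line_scale (- s) \o coord 0)) J = 0.
  apply: (SAF_eq0 _ v0 (oner_neq0 _)) => w.
  by rewrite /= /line_scale /coord /cross !mxE /=; ring.
split=> [[_ /h ->]|/eqP]; first by rewrite oppr0.
by rewrite oppr_eq0 => /eqP /h.
Qed.

(** The shear replaces the coordinates [x, y] by [x + y, y], so the mixed form of [x] and [y]
    changes by the mixed form of [y] with itself, which is twice [ext_map (coord 1) J]. *)
Lemma periodic_of_upper J :
  bivector_act (upper 1) J = J -> periodic_direction J (vec2 1 0).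
Proof.
move=> uJ; apply/periodic_horizontal.
have := congr1 (ext_mix (coord 0) (coord 1)) uJ.
rewrite -ext_mix_map.
have e0 : coord 0 \o plane_act (upper 1) =1 coord 0 \+ coord 1.
  by move=> w; rewrite /= plane_act_mx22 /coord !mxE /= !mul1r.
have e1 : coord 1 \o plane_act (upper 1) =1 coord 1.
  by move=> w; rewrite /= plane_act_mx22 /coord !mxE /= mul0r mul1r add0r.
rewrite (eq_ext_mix e0 e1) ext_mixDl => /(canRL (addKr _)); rewrite addNr.
rewrite ext_mixxx -scaler_nat => /eqP; rewrite scaler_eq0 => /orP[|/eqP //].
by rewrite pnatr_eq0.
Qed.

(** The identity is the sum of the two coordinate projectors; the pure terms of its polarization
    vanish on [J]. *)
Lemma axis_coord J : ext_map (coord 0) J = 0 -> ext_map (coord 1) J = 0 ->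
  ext_mix (axis 0 \o coord 0) (axis 1 \o coord 1) J = J.
Proof.
move=> J0 J1; have e : plane_act 1%:M =1 (axis 0 \o coord 0) \+ (axis 1 \o coord 1).
  move=> w; rewrite plane_act1 /=; apply: col2P;
  by rewrite /axis /coord !mxE /= ?mulr1 ?mulr0 ?addr0 ?add0r.
rewrite -[RHS]bivector_act1 /bivector_act (eq_ext_map e) ext_mapD.
by rewrite !ext_map_comp J0 J1 !linear0 !add0r.
Qed.

Lemma upper_of_periodic J s :
    periodic_direction J (vec2 1 0) -> periodic_direction J (vec2 0 1) ->
    periodic_direction J (vec2 1 1) -> periodic_direction J (vec2 1 s) ->
  bivector_act (upper s) J = J.
Proof.
move=> /periodic_horizontal J1 /periodic_vertical J0.
move=> /(periodic_slope _ J0 J1) T1 /(periodic_slope _ J0 J1) Ts.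
pose sw := (axis 0 \o coord 1) \+ (axis 1 \o coord 0).
(* Slope 1 kills the mixed form of the coordinates. Mapped back to the plane, this form is the sum
   of [J] and its image under the exchange. *)
have swJ : ext_map sw J = - J.
  have e : line_scale 1 \o coord 0 =1 coord 0.
    by move=> w; rewrite /= /line_scale mul1r.
  rewrite (eq_ext_mix (frefl _) e) in T1.
  have := ext_mix_mix (axis 1) (axis 0) (coord 1) (coord 0) J.
  rewrite T1 linear0 [ext_mix (axis 1 \o coord 1) _ _]ext_mixC axis_coord //.
  rewrite ext_mixC => /esym/eqP; rewrite addrC addr_eq0 => /eqP <-.
  by rewrite ext_mapD !ext_map_comp J0 J1 !linear0 !add0r.
(* The exchange turns this mixed form into the one that vanishes for slope [s], at the cost of a
   sign. *)
have Ms : ext_mix (coord 0) (line_scale s \o coord 1) J = 0.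
  apply: oppr_inj; rewrite oppr0 -Ts.
  transitivity (ext_mix (coord 0) (line_scale s \o coord 1) (ext_map sw J)).
    by rewrite swJ linearN.
  rewrite -ext_mix_map.
  have e0 : coord 0 \o sw =1 coord 1.
    by move=> w; rewrite /= /coord /axis !mxE /= mulr1 mulr0 addr0.
  have e1 : (line_scale s \o coord 1) \o sw =1 line_scale s \o coord 0.
    by move=> w; rewrite /= /line_scale /coord /axis !mxE /= mulr1 mulr0 add0r.
  by rewrite (eq_ext_mix e0 e1).
(* In the expansion below, the pure terms vanish by [J0], [J1] and [Ms]. The mixed term is [J] plus
   a term factoring through [ext_map (coord 1) J = 0]. *)
have e : plane_act (upper s) =1
    (axis 0 \o (coord 0 \+ (line_scale s \o coord 1))) \+ (axis 1 \o coord 1).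
  move=> w; rewrite plane_act_mx22 /=; apply: col2P;
  rewrite /axis /line_scale /coord !mxE /=; ring.
rewrite /bivector_act (eq_ext_map e) ext_mapD !ext_map_comp ext_mapD J0 J1 Ms.
rewrite ext_map_comp J1 !linear0 !addr0 linear0 add0r.
have e' : axis 0 \o (coord 0 \+ (line_scale s \o coord 1)) =1
   (axis 0 \o coord 0) \+ ((axis 0 \o line_scale s) \o coord 1).
  by move=> w; rewrite /= linearD.
rewrite (eq_ext_mix e' (frefl _)) ext_mixDl axis_coord // ext_mix_map J1 linear0.
by rewrite addr0.
Qed.

End PlaneMaps.

(** * Rational directions *)

Section RationalDirections.
Variables (K : fieldType) (R : realType) (F : {rmorphism K -> R}).
Implicit Types (v : 'cV[R]_2) (k : 'M[R]_2).

(** Points of the projective line over the image of [F], as real vectors. The zero vector also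
    qualifies, so nonvanishing is stated separately in [standard_periodic]. *)
Definition rational_direction v := exists c a b, v = c *: vec2 (F a) (F b).

(** A projective map is determined by the images of three points: rationality of the third image
    forces the real scalars of the two columns to have a rational ratio. *)
Lemma projective_frame k : k \in unitmx ->
    rational_direction (k *m vec2 1 0) -> rational_direction (k *m vec2 0 1) ->
    rational_direction (k *m vec2 1 1) ->
  exists c a1 a2 b1 b2,
    k = c *: mx22 (F a1) (F a2) (F b1) (F b2) /\ a1 * b2 - a2 * b1 != 0.
Proof.
have [x [y [z [w ->]]]] := mx22P k.
rewrite unitmxE det_mx22 unitfE => dk.
move=> [c1 [a1 [b1 /colP e1]]] [c2 [a2 [b2 /colP e2]]] [c3 [a3 [b3 /colP e3]]].
have := (e1 0, e1 1, (e2 0, e2 1), (e3 0, e3 1)).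
rewrite !mulmx_col2 !mxE /= !mulr1 !mulr0 !addr0 !add0r.
move=> [[[{}e1 f1] [{}e2 f2]] [{}e3 f3]].
have [d dE'] : exists d, d = a1 * b2 - a2 * b1 by eexists.
have dE : x * w - y * z = c1 * c2 * F d.
  by rewrite e1 e2 f1 f2 dE' rmorphB !rmorphM; ring.
move: dk; rewrite dE !mulf_eq0 !negb_or fmorph_eq0 -andbA => /and3P[c10 c20 d0].
have Fd0 : F d != 0 by rewrite fmorph_eq0.
(* Cramer's rule expresses the third vector in terms of the first two. *)
pose m1 := (a3 * b2 - b3 * a2) / d; pose m2 := (a1 * b3 - b1 * a3) / d.
rewrite e1 e2 in e3; rewrite f1 f2 in f3.
have c1E : c1 = c3 * F m1.
  apply: (mulIf Fd0); transitivity (c3 * F a3 * F b2 - c3 * F b3 * F a2).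
    by rewrite -e3 -f3 dE' rmorphB !rmorphM; ring.
  by rewrite -[RHS]mulrA -rmorphM /m1 divfK // rmorphB !rmorphM; ring.
have c2E : c2 = c3 * F m2.
  apply: (mulIf Fd0); transitivity (F a1 * (c3 * F b3) - F b1 * (c3 * F a3)).
    by rewrite -e3 -f3 dE' rmorphB !rmorphM; ring.
  by rewrite -[RHS]mulrA -rmorphM /m2 divfK // rmorphB !rmorphM; ring.
exists c3, (m1 * a1), (m2 * a2), (m1 * b1), (m2 * b2); split.
  by rewrite scalemx22 e1 e2 f1 f2 c1E c2E !rmorphM !mulrA.
have -> : m1 * a1 * (m2 * b2) - m2 * a2 * (m1 * b1) = m1 * m2 * d.
  by rewrite dE'; ring.
apply: mulf_neq0 => //; apply: mulf_neq0.
  by apply: contra c10 => /eqP m0; rewrite c1E m0 rmorph0 mulr0.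
by apply: contra c20 => /eqP m0; rewrite c2E m0 rmorph0 mulr0.
Qed.

Lemma rational_slope k s : k \in unitmx ->
    rational_direction (k *m vec2 1 0) -> rational_direction (k *m vec2 0 1) ->
    rational_direction (k *m vec2 1 1) ->
  rational_direction (k *m vec2 1 s) <-> exists b, F b = s.
Proof.
move=> uk r1 r2 r3; have [c [a1 [a2 [b1 [b2 [kE d0]]]]]] := projective_frame uk r1 r2 r3.
have ksE : k *m vec2 1 s = c *: vec2 (F a1 + F a2 * s) (F b1 + F b2 * s).
  by rewrite kE scalemx22; apply: col2P; rewrite mulmx_col2 !mxE /=; ring.
split=> [[c' [a [b]]]|[b bs]]; last first.
  exists c, (a1 + a2 * b), (b1 + b2 * b).
  by rewrite ksE !rmorphD !rmorphM bs.
rewrite ksE => /colP e; have := (e 0, e 1); rewrite !mxE /= => -[{}e f].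
have c0 : c != 0.
  apply: contraTneq uk => c0; rewrite kE c0 scale0r unitmxE.
  by rewrite -[0](scale0r 1%:M) detZ expr0n /= mul0r unitr0.
(* Applying the adjugate of the rational matrix to [(a, b)] gives a vector proportional to [(1, s)],
   with first coordinate [q]. *)
pose d := a1 * b2 - a2 * b1; pose q := b2 * a - a2 * b.
have e1 : c' * F q = c * F d.
  transitivity (F b2 * (c' * F a) - F a2 * (c' * F b)).
    by rewrite /q rmorphB !rmorphM; ring.
  by rewrite -e -f /d rmorphB !rmorphM; ring.
have e2 : c' * F (a1 * b - b1 * a) = c * F d * s.
  transitivity (F a1 * (c' * F b) - F b1 * (c' * F a)).
    by rewrite rmorphB !rmorphM; ring.
  by rewrite -e -f /d rmorphB !rmorphM; ring.
have cd0 : c * F d != 0 by rewrite mulf_neq0 // fmorph_eq0.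
have : c' * F q != 0 by rewrite e1.
rewrite mulf_eq0 negb_or => /andP[c'0 q0].
exists ((a1 * b - b1 * a) / q).
apply: (mulfI cd0); rewrite -e2 -e1 fmorph_div; field.
by rewrite q0.
Qed.

End RationalDirections.

(** * Periodic directions of a bivector in normalized coordinates *)

Section StandardBivector.
Variables (K : fieldType) (R : realType) (F : {rmorphism K -> R}).
Variable J : ext_sq (plane R).
Hypothesis J_upper : forall b, bivector_act (upper (F b)) J = J.
Hypothesis J_lower : forall b, bivector_act (lower (F b)) J = J.
Hypothesis J_weyl : bivector_act (weyl R) J = J.
Hypothesis upper_J : forall s, bivector_act (upper s) J = J -> exists b, F b = s.

Lemma standard_horizontal : periodic_direction J (vec2 1 0).
Proof. by apply: periodic_of_upper; rewrite -{1}(rmorph1 F). Qed.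

Lemma standard_vertical : periodic_direction J (vec2 0 1).
Proof.
have -> : vec2 0 1 = -1 *: (weyl R *m vec2 1 0).
  by apply: col2P; rewrite [RHS]mxE mulmx_col2 !mxE /=; ring.
rewrite -J_weyl; apply: periodic_act standard_horizontal.
  by rewrite unitmxE (eqP (det_weyl R)) unitr1.
by rewrite oppr_eq0 oner_eq0.
Qed.

Lemma standard_slopes s : periodic_direction J (vec2 1 s) <-> exists b, F b = s.
Proof.
have slopeF b : periodic_direction J (vec2 1 (F b)).
  have -> : vec2 1 (F b) = 1 *: (lower (F b) *m vec2 1 0).
    by apply: col2P; rewrite [RHS]mxE mulmx_col2 !mxE /=; ring.
  rewrite -(J_lower b); apply: periodic_act standard_horizontal.
    by rewrite unitmxE (eqP (det_lower _)) unitr1.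
  exact: oner_neq0.
split=> [Js|[b <-] //]; apply/upper_J/upper_of_periodic => //.
- exact: standard_horizontal.
- exact: standard_vertical.
- by have := slopeF 1; rewrite rmorph1.
Qed.

Lemma periodic_scale v (c : R) : c != 0 ->
  periodic_direction J v -> periodic_direction J (c *: v).
Proof.
move=> c0 /(periodic_act (unitmx1 _ _) c0).
by rewrite bivector_act1 mul1mx.
Qed.

Lemma standard_periodic v :
  periodic_direction J v <-> v != 0 /\ rational_direction F v.
Proof.
split=> [Jv|[v0 [c [a [b vE]]]]].
  split; first by case: Jv.
  have [x0|x0] := eqVneq (v 0 0) 0.
    exists (v 1 0), 0, 1; rewrite rmorph0 rmorph1.
    by apply: col2P; rewrite !mxE /= ?mulr0 ?mulr1.
  have : periodic_direction J ((v 0 0)^-1 *: v).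
    by apply: periodic_scale => //; rewrite invr_eq0.
  have -> : (v 0 0)^-1 *: v = vec2 1 (v 1 0 / v 0 0).
    by apply: col2P; rewrite !mxE /= mulrC ?mulfV.
  move=> /standard_slopes[b bE]; exists (v 0 0), 1, b; rewrite rmorph1 bE.
  by apply: col2P; rewrite !mxE /= ?mulr1 // mulrCA mulfV // mulr1.
have [c0|c0] := eqVneq c 0; first by rewrite vE c0 scale0r eqxx in v0.
have [a0|a0] := eqVneq a 0.
  have [b0|b0] := eqVneq b 0.
    case/eqP: v0; rewrite vE a0 b0 rmorph0.
    by apply: col2P; rewrite !mxE mulr0.
  have -> : v = (c * F b) *: vec2 0 1.
    by rewrite vE a0 rmorph0; apply: col2P; rewrite !mxE /= ?mulr0 ?mulr1.
  apply: periodic_scale standard_vertical.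
  by rewrite mulf_neq0 // fmorph_eq0.
have -> : v = (c * F a) *: vec2 1 (F (b / a)).
  rewrite vE; apply: col2P; rewrite !mxE /= ?mulr1 // -mulrA -rmorphM mulrCA.
  by rewrite mulfV // mulr1.
apply: periodic_scale; first by rewrite mulf_neq0 // fmorph_eq0.
by apply/standard_slopes; exists (b / a).
Qed.

End StandardBivector.

(** The inverse isomorphism, followed by the inclusion in SL(2,R), is an embedding of SL(2,K). Its
    normal form gives the four stabilizing conditions, and its surjectivity onto [Iso J] gives the
    last clause. *)
Lemma Iso_standard (R : realType) (K : fieldType) (J : ext_sq (plane R)) :
    group_isomorphic (Iso J) (SL2 K) ->
  exists (P : 'M[R]_2) (F : {rmorphism K -> R}), let J' := bivector_act P J in
  [/\ P \in unitmx, forall b, bivector_act (upper (F b)) J' = J',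
      forall b, bivector_act (lower (F b)) J' = J', bivector_act (weyl R) J' = J' &
      forall s, bivector_act (upper s) J' = J' -> exists b, F b = s].
Proof.
case=> f [g fK gK].
have gM x y : g (x * y)%g = (g x * g y)%g.
  by apply: (can_inj fK); rewrite gmulfM !gK.
pose phi x : 'M[R]_2 := val (val (g x)).
have phiM x y : phi (x * y)%g = phi x *m phi y by rewrite /phi gM.
have dphi x : \det (phi x) = 1 by exact: det_SL2.
have phi_inj : injective phi by move=> x y /val_inj /val_inj /(can_inj gK).
have phi_fix x : bivector_act (phi x) J = J by have /asboolP := valP (g x).
have fix_phi M : \det M = 1 -> bivector_act M J = J -> exists x, phi x = M.
  move=> /eqP dM /asboolP MJ; exists (f (@MkIso _ J (MkSL2 dM) MJ)).
  by rewrite /phi fK.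
have [P [F [uP [hU hL hW]]]] := SL2_embedding phiM dphi phi_inj.
have actM M N x : bivector_act (M *m N) x = bivector_act M (bivector_act N x).
  exact: bivector_actM.
exists (invmx P), F => J'.
have PJ' : bivector_act P J' = J.
  by rewrite /J' -actM mulmxV // bivector_act1.
have fixJ' x : bivector_act (invmx P *m phi x *m P) J' = J'.
  by rewrite 2!actM PJ' phi_fix.
split.
- by rewrite unitmx_inv.
- by move=> b; rewrite -hU fixJ'.
- by move=> b; rewrite -hL fixJ'.
- by rewrite -hW fixJ'.
move=> s sJ'.
have [x xE] : exists x, phi x = P *m upper s *m invmx P.
  apply: fix_phi.
    by rewrite !det_mulmx det_inv (eqP (det_upper s)) mulr1 mulrV.
  by rewrite 2!actM sJ' PJ'.
have xE' : invmx P *m phi x *m P = upper s.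
  by rewrite xE !mulmxA mulVmx // mul1mx mulmxKV.
(* Commutation holds after embedding, hence in SL(2,K), where it forces [x] to be plus or minus an
   upper transvection. *)
have : (x * SLupper 1)%g = (SLupper 1 * x)%g.
  apply: phi_inj; rewrite !phiM.
  have U1 : phi (SLupper 1) = P *m upper 1 *m invmx P.
    by rewrite -(rmorph1 F) -hU !mulmxA mulmxV // mul1mx mulmxK.
  rewrite xE U1 !mulmxA !(mulmxKV uP) -!mulmxA; congr (_ *m _).
  by rewrite !mulmxA; congr (_ *m _); rewrite !mulmx22; congr mx22; ring.
move=> /(congr1 val) /= /commute_upper1[a [b ab]].
have a2 : a ^+ 2 = 1.
  by have := det_SL2 x; rewrite /= ab det_mx22 => <-; ring.
have [a1|aN1] : a = 1 \/ a = -1.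
  by move/eqP: a2; rewrite sqrf_eq1 => /orP[]/eqP; [left|right].
  exists b; have xb : x = SLupper b by apply: val_inj; rewrite /= ab a1.
  by move: xE'; rewrite xb hU => /mx22_inj[_ ->].
(* The square of the Weyl element is -1, so the image of [x] would have diagonal entries -1, unlike
   [upper s]. *)
have xb : x = (SLweyl K * SLweyl K * SLupper (- b))%g.
  by apply: val_inj; rewrite /= ab aN1 !mulmx22; congr mx22; ring.
move: xE'; rewrite xb !phiM.
have -> : invmx P *m
    (phi (SLweyl K) *m phi (SLweyl K) *m phi (SLupper (- b))) *m P =
   weyl R *m weyl R *m upper (F (- b)).
  by rewrite -hW -hU !mulmxA !(mulmxK uP).
rewrite !mulmx22 => /mx22_inj[e _ _ _].
have : 2 = 0 :> R by lra.
by move/eqP; rewrite pnatr_eq0.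
Qed.

Theorem theorem1p13 (R : realType) (S : translation_surface R) (K : fieldType) :
  group_isomorphic (Iso (J_invariant S)) (SL2 K) ->
  [/\ algebraically_periodic S,
      exists L : set R, periodic_direction_field S L &
      forall L : set R, periodic_direction_field S L ->
        isomorphic_to_subfield K L].
Proof.
set J := J_invariant S => /Iso_standard[P [F [uP hU hL hW hs]]].
set J' := bivector_act P J in hU hL hW hs.
have h0 := standard_horizontal hU.
have hoo := standard_vertical hU hW.
have slopes := standard_slopes hU hL hW hs.
have periodic := standard_periodic hU hL hW hs.
have h1 : periodic_direction J' (vec2 1 1).
  by apply/slopes; exists 1; rewrite rmorph1.
have actK Q x : Q \in unitmx -> bivector_act (invmx Q) (bivector_act Q x) = x.
  move=> uQ; have /= <- := bivector_actM (invmx Q) Q x.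
  by rewrite mulVmx // bivector_act1.
split; rewrite /algebraically_periodic /periodic_direction_field; rewrite -?/J.
- pose u (i : 'I_3) : 'cV[R]_2 :=
    if i == 0 then vec2 1 0 else if i == 1 then vec2 1 1 else vec2 0 1.
  exists (fun i => 1 *: (invmx P *m u i)); split=> [i|i j ij].
    rewrite -(actK _ P J uP); apply: periodic_act; rewrite ?unitmx_inv ?oner_neq0 //.
    by rewrite /u; case: eqP => // _; case: eqP.
  rewrite !scale1r cross_mulmx mulf_neq0 //.
    by rewrite -unitfE -unitmxE unitmx_inv.
  move: i j ij => [[|[|[|//]]] ?] [[|[|[|//]]] ?] // _;
  rewrite /cross /u /= !mxE /= !(mulr0, mul0r, mulr1, subr0, sub0r, oppr_eq0);
  by rewrite ?subrr ?oner_neq0.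
- by exists (periodic_slopes J'), P.
move=> L [g [ug g0 g1 goo ->]]; set J'' := bivector_act g J in g0 g1 goo *.
(* Passage from an arbitrary normalizing coordinate system to the standard one; it sends the slopes
   0, 1 and infinity to rational directions. *)
pose k := P *m invmx g.
have uk : k \in unitmx by rewrite unitmx_mul uP unitmx_inv.
have J'E : J' = bivector_act k J''.
  by have /= -> := bivector_actM P (invmx g) J''; rewrite actK.
have J''E : J'' = bivector_act (invmx k) J' by rewrite J'E actK.
have pk v : periodic_direction J'' v <-> periodic_direction J' (k *m v).
  split=> [pv|].
    by rewrite J'E -[_ *m v]scale1r; apply: periodic_act; rewrite ?oner_neq0.
  rewrite J''E -{2}(mulKmx uk v) -[invmx k *m _]scale1r.
  by apply: periodic_act; rewrite ?unitmx_inv ?oner_neq0.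
have rat v : periodic_direction J'' v -> rational_direction F (k *m v).
  by move=> /pk /periodic[].
exists F; apply/seteqP; split=> [_ [b _ <-]|s].
  apply/pk/periodic; split.
    apply/eqP => /(congr1 (mulmx (invmx k))); rewrite mulKmx // mulmx0.
    by move=> /colP/(_ 0); rewrite !mxE => /eqP; rewrite oner_eq0.
  by apply/rational_slope; try exact: rat; last by exists b.
by move=> /rat /(rational_slope _ uk (rat _ g0) (rat _ goo) (rat _ g1))[b]; exists b.
Qed.
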